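(* Let $\Delta$ be an analytic polydisk and let $(U_ig_i,\alpha)_{i\in I}$ be an analytic family, parametrized by $\Delta$, of framed connections $d+\alpha\,dz$ on $\mathbb P^1$ of the type described in the context (poles $\xi_i$, Iwahori $P_i$, $r_i=1$, normalized formal type $\frac1{z_i}(-\frac{a_i}{n}\varpi_i^{-1}+H_T)$ at $\xi_i$). The isomonodromy equations of the family are $$(d g_i)g_i^{-1}\equiv\sum_{j\in I\setminus\{i\}}\frac1{\xi_i-\xi_j}\mathrm{Ad}(g_ig_j^{-1})(E'\,da_j)-\Big(N'\,da_i+D_i\frac{da_i}{a_i}\Big)\pmod{\mathfrak u_i}\qquad(i\in I),$$ an identity in $(\mathfrak u_i\backslash\mathfrak{gl}_n(\mathbb C))\times_{U_i}\mathrm{GL}_n(\mathbb C)$, and $$d\varrho_i=\sum_{j\in I\setminus\{i\}}\Big(\frac1{\xi_j-\xi_i}\big([\mathrm{Ad}(g_j^{-1})E',\varrho_i]\,da_j+[\mathrm{Ad}(g_i^{-1})E',\varrho_j]\,da_i\big)+\frac1n\frac1{(\xi_j-\xi_i)^2}[\mathrm{Ad}(g_i^{-1})E',\mathrm{Ad}(g_j^{-1})E']\,d(a_ia_j)\Big)\qquad(i\in I).$$ That is, the family satisfies conditions (I) and (II) of the context for all $i\in I$ if and only if it satisfies these two systems of equations.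
   Context: **Setting.** Let $z$ be the usual coordinate on $\mathbb P^1(\mathbb C)$, $\xi_i\in\mathbb C$ ($i\in I$, $I$ finite) distinct points, $z_i=z-\xi_i$, $\nu=dz$, $\tau_\nu=\partial_z$, and $d$ the exterior differential on $\Delta$ (so $dz$ is treated as the $\mathbb P^1$ direction). Let $\mathfrak o_i=\mathbb C[[z_i]]$, $\mathfrak g_i=\mathfrak{gl}_n(\mathfrak o_i)$, $\mathfrak g_i^1=z_i\mathfrak g_i$. $N$ is the $n\times n$ regular nilpotent Jordan matrix ($1$'s on the superdiagonal), $E=E_{n1}$, and $N',E'$ their transposes. $P_i=I_i\subset\mathrm{GL}_n(\mathfrak o_i)$ is the standard Iwahori subgroup (upper triangular mod $z_i$), with Lie algebra $\mathfrak I_i$, radical $\mathfrak I_i^1$ (strictly upper triangular mod $z_i$), $P_i^1=1+\mathfrak I_i^1$; $U_i=P_i^1\cap\mathrm{GL}_n(\mathbb C)$ is the group of upper triangular unipotent matrices and $\mathfrak u_i$ its Lie algebra. $\varpi_i=N+z_iE$, so $\varpi_i^{-1}=N'+\frac1{z_i}E'$. $H_T=\mathrm{diag}(\frac{n-1}{2n},\frac{n-3}{2n},\dots,\frac{1-n}{2n})$. **The family.** For each $y\in\Delta$, $d_z+\alpha\,dz$ is a meromorphic connection on the trivial rank $n$ bundle with poles only at the $\xi_i$ (regular at $\infty$, so $\sum_i\mathrm{Res}_{\xi_i}(\alpha\,dz)=0$), with framings $g_i:\Delta\to\mathrm{GL}_n(\mathbb C)$ defined up to left multiplication by $U_i$,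 and there are nonvanishing analytic functions $a_i$ on $\Delta$, traceless diagonal $D_i$ and $X_i\in\mathfrak u_i$ (analytic in $y$) such that $$\mathrm{Ad}(g_i)(\alpha)\in\tfrac1{z_i}\big(-\tfrac{a_i}n\varpi_i^{-1}-\tfrac1n(D_i+X_i)+H_T\big)+\mathfrak g_i ,$$ and there is an analytic $p_i:\Delta\to P_i^1$ such that with $\hat g_i=p_ig_i$, $\mathrm{Ad}(\hat g_i)(\alpha)-(\partial_z\hat g_i)\hat g_i^{-1}=\frac1{z_i}(-\frac{a_i}n\varpi_i^{-1}+H_T)$ (normalized formal type). Put $\varrho_i=\mathrm{Res}_{\xi_i}(\alpha\,dz)=\mathrm{Ad}(g_i^{-1})\big(-\frac1n(a_iN'+D_i+X_i)+H_T\big)$. **Isomonodromy equations.** Let $A_{i,\Delta}=\varpi_i^{-1}da_i$; let $\tilde\Upsilon_i$ be the unique lift to $\Omega^1_\Delta(\mathfrak{gl}_n(z_i^{-1}\mathbb C[z_i^{-1}]))$ of $\mathrm{Ad}(\hat g_i^{-1})A_{i,\Delta}$ mod $\mathfrak g_i$, and $\Upsilon^0=\sum_{i\in I}\tilde\Upsilon_i$. Let $\phi_i(X)=\mathrm{Res}_{\xi_i}(X\frac{dz}{z_i})$ be the constant term at $\xi_i$. The isomonodromy equations are the conditions, for all $i\in I$: (I) $\phi_i(\mathrm{Ad}(p_i^{-1})A_{i,\Delta}+(dg_i)g_i^{-1})\in\phi_i(\mathrm{Ad}(g_i)\Upsilon^0)+\Omega^1_\Delta(\mathfrak u_i)$;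 (II) $d\alpha\in\partial_z\Upsilon^0+[\alpha,\Upsilon^0]+\Omega^1_\Delta(\mathfrak g_i^1\frac1{z_i})$ (expansions at $\xi_i$). *)

(* Defs.v *)
From HB Require Import structures.
From mathcomp Require Import all_boot all_order all_algebra.
From mathcomp Require Import complex.
From mathcomp Require Import boolp classical_sets functions cardinality fsbigop.
From mathcomp Require Import reals topology normedtype sequences derive.

Set Implicit Arguments.
Unset Strict Implicit.
Unset Printing Implicit Defensive.

Import Order.TTheory GRing.Theory Num.Theory.
Import numFieldNormedType.Exports.

Local Open Scope classical_set_scope.
Local Open Scope ring_scope.

(* The alias gives R[i] the topology and norm that MathComp-Analysis attaches
   to every numFieldType. *)
Definition Cplx (R : realType) : numClosedFieldType := R[i].

Section Analytic.
Context {R : realType} {m : nat}.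
Local Notation C := (Cplx R).

(* Radii are elements of C: 0 < r k forces r k to be a positive real. *)
Definition polydisk (c : 'rV[C]_m) (r : 'I_m -> C) : set 'rV[C]_m :=
  [set y | forall k, `|y 0 k - c 0 k| < r k].

(* f is, near x, the sum of an absolutely convergent power series; the partial
   sum of rank k runs over the multi-indices all of whose entries are < k. *)
Definition analytic_at (f : 'rV[C]_m -> C) (x : 'rV[C]_m) : Prop :=
  exists (c : {ffun 'I_m -> nat} -> C) (r M : C),
  [/\ 0 < r,
      forall k : nat, \sum_(e : {ffun 'I_m -> 'I_k})
        `|c [ffun j => e j : nat]| * \prod_j r ^+ e j <= M &
      forall y, polydisk x (fun=> r) y ->
        (fun k : nat => \sum_(e : {ffun 'I_m -> 'I_k})
          c [ffun j => e j : nat] * \prod_j (y 0 j - x 0 j) ^+ e j)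
        @ \oo --> f y].

Definition analytic (Delta : set 'rV[C]_m) (f : 'rV[C]_m -> C) : Prop :=
  forall y, Delta y -> analytic_at f y.

Definition analytic_mx n (Delta : set 'rV[C]_m) (f : 'rV[C]_m -> 'M[C]_n) :=
  forall i j, analytic Delta (fun y => f y i j).

End Analytic.

(* A formal Laurent series sum_k L_k z^k is represented by its coefficient
   function L : int -> V, subject to is_laurent; V is C or 'M[C]_n, the latter
   through gl_n(C((z))) = gl_n(C)((z)). *)
Section Laurent.
Context {V : pzRingType}.
Implicit Types A B : int -> V.

Definition is_laurent A : Prop := exists N : int, forall k, k < N -> A k = 0.

Definition lconst (c : V) : int -> V := fun k => if k == 0 then c else 0.

(* The sum has finite support when A and B are Laurent series. *)
Definition lmul A B : int -> V := fun k => \sum_(i \in [set: int]) A i * B (k - i).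

(* z^r A *)
Definition zshift (r : int) A : int -> V := fun k => A (k - r).

Definition lderiv A : int -> V := fun k => A (k + 1) *~ (k + 1).

Definition linv A : int -> V :=
  xget 0 [set B | [/\ is_laurent B, lmul A B = lconst 1 & lmul B A = lconst 1]].

Definition Ad A B : int -> V := lmul (lmul A B) (linv A).

Definition lbracket A B : int -> V := lmul A B - lmul B A.

Definition residue A : V := A (-1).

(* Res (A dz / z) *)
Definition phi A : V := residue (zshift (-1) A).

End Laurent.

Section Rational.
Context {R : realType}.
Local Notation C := (Cplx R).
Local Notation ratfun := {fraction {poly C}}.

Definition lpoly (p : {poly C}) : int -> C :=
  fun k => if k is Posz l then p`_l else 0.

(* The expansion of p / q at xi is the L with q(xi + t) L = p(xi + t). *)
Definition is_expansion (xi : C) (f : ratfun) (L : int -> C) : Prop :=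
  is_laurent L /\ exists p q : {poly C},
    [/\ q != 0, f = FracField.tofrac p / FracField.tofrac q &
        lmul (lpoly (q \Po ('X + xi%:P))) L = lpoly (p \Po ('X + xi%:P))].

Definition expand (xi : C) (f : ratfun) : int -> C := xget 0 (is_expansion xi f).

(* f dz is regular at infinity: with w = 1/z, f dz = - f(1/w) w^-2 dw, so f
   vanishes there to order at least 2. *)
Definition regular_at_infty (f : ratfun) : Prop :=
  exists p q : {poly C},
    [/\ q != 0, f = FracField.tofrac p / FracField.tofrac q &
        (size p <= (size q).-2)%N].

Context {n : nat}.

Definition expand_mx (xi : C) (M : 'M[ratfun]_n) : int -> 'M[C]_n :=
  fun k => \matrix_(i, j) expand xi (M i j) k.

(* sum_(k > 0) L_(-k) (z - xi)^-k: the lift of L mod gl_n(C[[z - xi]]) to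
   gl_n((z - xi)^-1 C[(z - xi)^-1]) *)
Definition principal_part (xi : C) (L : int -> 'M[C]_n) : 'M[ratfun]_n :=
  \sum_(k \in [set k : nat | (0 < k)%N])
    FracField.tofrac ('X - xi%:P) ^- k *:
      map_mx (fun c => FracField.tofrac c%:P) (L (- k%:Z)).

(* alpha is a family of matrices of rational functions with poles only at the
   xi_i, depending analytically on y *)
Definition analytic_family (I : finType) m (Delta : set 'rV[C]_m) (xi : I -> C)
    (alpha : 'rV[C]_m -> 'M[ratfun]_n) : Prop :=
  exists (K : nat) (P : 'rV[C]_m -> 'M[{poly C}]_n),
    (forall y, Delta y ->
      alpha y = (\prod_i FracField.tofrac ('X - (xi i)%:P)) ^- K *:
                map_mx (@FracField.tofrac _) (P y)) /\
    (forall i j k, analytic Delta (fun y => (P y i j)`_k)).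

End Rational.

Section Matrices.
Context {R : realType} {n : nat}.
Local Notation C := (Cplx R).

Definition matN : 'M[C]_n := \matrix_(i, j) (j == i.+1 :> nat)%:R.
Definition matE : 'M[C]_n := \matrix_(i, j) ((i.+1 == n) && (j == 0 :> nat))%:R.

(* Indices start at 0: the diagonal runs from (n-1)/2n to (1-n)/2n. *)
Definition matHT : 'M[C]_n :=
  diag_mx (\row_(i < n) ((n%:R - 1 - (2 * i)%:R) / (2 * n)%:R)).

Definition varpi : int -> 'M[C]_n := lconst matN + zshift 1 (lconst matE).

Definition lscale (c : C) (L : int -> 'M[C]_n) : int -> 'M[C]_n :=
  fun k => c *: L k.

Definition gl_o : set (int -> 'M[C]_n) := [set L | forall k, k < 0 -> L k = 0].
Definition gl_o1 : set (int -> 'M[C]_n) := zshift 1 @` gl_o.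

Definition lie_u : set 'M[C]_n := [set M | forall i j : 'I_n, (j <= i)%N -> M i j = 0].
Definition iwahori1 : set (int -> 'M[C]_n) := [set L | gl_o L /\ lie_u (L 0)].
Definition P1 : set (int -> 'M[C]_n) := [set p | iwahori1 (p - lconst 1)].
Definition grpU : set 'M[C]_n := [set u | P1 (lconst u)].

Definition Adm (g M : 'M[C]_n) : 'M[C]_n := g *m M *m invmx g.
Definition bracket (A B : 'M[C]_n) : 'M[C]_n := A *m B - B *m A.

(* Equality of the classes of (A, g) and (B, h) in (u \ gl_n) x_U GL_n, where
   u in U acts by (A, g) |-> (Ad(u) A, u g). *)
Definition eq_fibre (A B g h : 'M[C]_n) : Prop :=
  exists u, [/\ grpU u, h = u *m g & lie_u (B - Adm u A)].

End Matrices.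

Arguments matN {R n}.
Arguments matE {R n}.
Arguments matHT {R n}.
Arguments varpi {R n}.

Section Family.
Context {R : realType} {I : finType} {n m : nat}.
Local Notation C := (Cplx R).
Local Notation ratfun := {fraction {poly C}}.
Context (Delta : set 'rV[C]_m) (xi : I -> C).
Context (alpha : 'rV[C]_m -> 'M[ratfun]_n) (g : I -> 'rV[C]_m -> 'M[C]_n).
Context (a : I -> 'rV[C]_m -> C) (D X : I -> 'rV[C]_m -> 'M[C]_n).
Context (p : I -> 'rV[C]_m -> int -> 'M[C]_n).

Definition ghat i y : int -> 'M[C]_n := lmul (p i y) (lconst (g i y)).

Record framed_family : Prop := FramedFamily {
  ff_alpha : analytic_family Delta xi alpha;
  ff_infty : forall y, Delta y -> forall j k, regular_at_infty (alpha y j k);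
  ff_g : forall i, analytic_mx Delta (g i);
  ff_g_unit : forall i y, Delta y -> g i y \in unitmx;
  ff_a : forall i, analytic Delta (a i);
  ff_a_neq0 : forall i y, Delta y -> a i y != 0;
  ff_D : forall i, analytic_mx Delta (D i);
  ff_D_diag : forall i y, Delta y -> is_diag_mx (D i y) /\ \tr (D i y) = 0;
  ff_X : forall i, analytic_mx Delta (X i);
  ff_X_u : forall i y, Delta y -> lie_u (X i y);
  ff_leading : forall i y, Delta y ->
    gl_o (Ad (lconst (g i y)) (expand_mx (xi i) (alpha y))
          - zshift (-1) (lscale (- (a i y / n%:R)) (linv varpi)
                         - lscale n%:R^-1 (lconst (D i y + X i y))
                         + lconst matHT));
  ff_p : forall i k, analytic_mx Delta (fun y => p i y k);
  ff_p_P1 : forall i y, Delta y -> P1 (p i y);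
  ff_formal_type : forall i y, Delta y ->
    Ad (ghat i y) (expand_mx (xi i) (alpha y))
      - lmul (lderiv (ghat i y)) (linv (ghat i y))
    = zshift (-1) (lscale (- (a i y / n%:R)) (linv varpi) + lconst matHT) }.

Definition rho i y : 'M[C]_n := residue (expand_mx (xi i) (alpha y)).

(* A 1-form on Delta is a function of a point y and a tangent vector v, the
   form df being 'd f y v; membership of a form in Omega^1(W) means that all its
   values on Delta lie in W. *)

Definition formA i y v : int -> 'M[C]_n :=
  lscale ('d (a i) y v) (linv varpi).

Definition Upsilon i y v : 'M[ratfun]_n :=
  principal_part (xi i) (Ad (linv (ghat i y)) (formA i y v)).

Definition Upsilon0 y v : 'M[ratfun]_n := \sum_i Upsilon i y v.

Definition isomonodromy1 i : Prop := forall y v, Delta y ->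
  lie_u (phi (Ad (linv (p i y)) (formA i y v)
              + lconst ('d (g i) y v *m invmx (g i y)))
         - phi (Ad (lconst (g i y)) (expand_mx (xi i) (Upsilon0 y v)))).

(* d alpha is taken coefficientwise in the expansion at xi_i. *)
Definition isomonodromy2 i : Prop := forall y v, Delta y ->
  let Y := expand_mx (xi i) (Upsilon0 y v) in
  (zshift (-1) @` gl_o1)
    ((fun k => 'd (fun y' => expand_mx (xi i) (alpha y') k) y v)
     - (lderiv Y + lbracket (expand_mx (xi i) (alpha y)) Y)).

End Family.

(* Main.v *)
(* Write F_j = Ad(g_j^-1) E'.  Since upper unipotent matrices commute with
   E' = E_{1n}, the lift of Ad(ghat_j^-1) A_j is F_j da_j / z_j; since alpha has
   double poles and is regular at infinity, partial fractions give
   alpha = sum_j (- a_j / n F_j / z_j^2 + rho_j / z_j).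
   Condition (I) becomes the first system once the constant term of
   Ad(p_i^-1) varpi_i^-1 is known modulo u: it is read off the z_i^-1 coefficient of
   the normalized formal type, as N' + D_i / a_i.
   Condition (II) has three nontrivial coefficients.  The one of z_i^-3 vanishes
   because F_i commutes with itself; the one of z_i^-1 is the second system; the one
   of z_i^-2 says that d(- a_i / n F_i) is the expected bracket, and follows from the
   first system because [u, E'] = 0 and [H_T, E'] = (n - 1) / n E'.
   Analyticity enters only through differentiability of the a_i and g_i. *)

Require Import Defs.
From mathcomp Require Import all_boot all_order all_algebra.
From mathcomp Require Import complex.
From mathcomp Require Import boolp classical_sets functions cardinality fsbigop.
From mathcomp Require Import reals topology normedtype sequences derive.
From mathcomp Require Import perm interval_inference landau.
From mathcomp Require Import zify ring.

Set Implicit Arguments.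
Unset Strict Implicit.
Unset Printing Implicit Defensive.

Import Order.TTheory GRing.Theory Num.Theory.
Import numFieldNormedType.Exports.

Local Open Scope classical_set_scope.
Local Open Scope ring_scope.

(** * Formal Laurent series *)

(** The obstacle is the gauge [p_i]: with [p_0], [p_1] its first two coefficients, the constant term
    of Ad(p_i^-1) varpi_i^-1 involves [p_1], which occurs in neither system. It enters only through
    the commutator of [E'] with [p_1]. Multiplied on the right by [p_i], the normal form becomes p B
    - p' = T p, with B = Ad(g_i) alpha and T the formal type. There the same commutator appears with
    the factor a_i / n, and p' contributes nothing, because a derivative has no z^-1 coefficient.
    Eliminating the commutator trades [p_1] for the residue of B; the leftover terms [H_T, p_0] and
    p_0 X_i lie in u. A second obstacle is that [linv] and [expand] are choices and that the family
    is constrained only over the polydisk. Inverses and expansions are therefore handled through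
    uniqueness statements, and differentials through germs. *)

Section LaurentTheory.
Context {V : pzRingType}.
Implicit Types (A B L : int -> V) (a b k : int).

Lemma lfunD A B k : (A + B) k = A k + B k. Proof. by []. Qed.
Lemma lfunN A k : (- A) k = - A k. Proof. by []. Qed.

Lemma lfunB_eq0 A B k : (A - B) k = 0 <-> A k = B k.
Proof. by rewrite lfunD lfunN; split=> [/eqP|->]; rewrite ?subrr// subr_eq0 => /eqP. Qed.

(** Only a lower bound for the order: the coefficient at [a] may vanish, so bounds simply add under
    products. *)
Definition val_ge a A := forall k, k < a -> A k = 0.

Lemma fsum_int1 (F : int -> V) (j : int) : (forall i, i != j -> F i = 0) ->
  \sum_(i \in [set: int]) F i = F j.
Proof.
move=> F0; transitivity (\sum_(i <- [:: j]) F i); last by rewrite big_seq1.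
rewrite [RHS]bigfs.
- by apply: eq_fsbigl; apply/seteqP; split.
- by [].
- by move=> i _; rewrite inE => /F0.
Qed.

(** A window symmetric about 0 serves series of different orders at once, so that sums can be added
    termwise and exchanged. *)
Lemma fsum_int_window (F : int -> V) (w : nat) :
    (forall i : int, (w < `|i|)%N -> F i = 0) ->
  \sum_(i \in [set: int]) F i =
  \sum_(0 <= i < (w + w).+1) F (i%:Z - w%:Z).
Proof.
move=> F0.
have inj : injective (fun i : nat => i%:Z - w%:Z) by move=> i j /= H; lia.
rewrite -(big_map (fun i : nat => i%:Z - w%:Z) xpredT F).
rewrite [RHS]bigfs.
- by apply: eq_fsbigl; apply/seteqP; split.
- by rewrite map_inj_uniq// iota_uniq.
- move=> i _ iW; apply: F0; rewrite ltnNge; apply/negP => iw.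
  move/negP: iW; apply; apply/mapP; exists (absz (i + w%:Z)); last by lia.
  by rewrite mem_index_iota; lia.
Qed.

Lemma lmul_window A B a b k (w : nat) : val_ge a A -> val_ge b B ->
    (`|a| <= w)%N -> (`|k - b| <= w)%N ->
  lmul A B k = \sum_(0 <= i < (w + w).+1) A (i%:Z - w%:Z) * B (k - (i%:Z - w%:Z)).
Proof.
move=> A0 B0 aw bw; apply: fsum_int_window => i iw.
have [ia|ai] := ltP i a; first by rewrite A0 ?mul0r.
by rewrite B0 ?mulr0//; lia.
Qed.

(** The sum is cut to the exact range left by the two orders, which is the form from which the
    lowest coefficients of a product are read off. *)
Lemma lmulE A B a b (l : nat) : val_ge a A -> val_ge b B ->
  lmul A B (a + b + l%:Z) =
  \sum_(0 <= i < l.+1) A (a + i%:Z) * B (b + (l - i)%N%:Z).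
Proof.
move=> A0 B0.
pose h (i : nat) : int := a + i%:Z.
transitivity (\sum_(i <- map h (iota 0 l.+1)) A i * B (a + b + l%:Z - i)).
  rewrite [RHS]bigfs.
  - by apply: eq_fsbigl; apply/seteqP; split.
  - by rewrite map_inj_uniq ?iota_uniq// => i j; rewrite /h => H; lia.
  - move=> i _ iW.
    have [ia|ai] := ltP i a; first by rewrite A0 ?mul0r.
    rewrite B0 ?mulr0//.
    have [il|il] := ltP (a + l%:Z) i; first lia.
    move/negP: iW; case; apply/mapP; exists `|i - a|%N; last by rewrite /h; lia.
    by rewrite mem_iota; lia.
rewrite big_map /index_iota subn0; apply: eq_big_seq => i.
rewrite mem_iota => il; congr (_ * B _); rewrite /h; lia.
Qed.

Lemma val_ge_lmul A B a b : val_ge a A -> val_ge b B -> val_ge (a + b) (lmul A B).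
Proof.
move=> A0 B0 k kab; rewrite /lmul fsbig1// => i _.
have [ia|ai] := ltP i a; first by rewrite A0 ?mul0r.
by rewrite B0 ?mulr0//; lia.
Qed.

Lemma val_ge_laurent A a : val_ge a A -> is_laurent A.
Proof. by exists a. Qed.

Lemma is_laurent_lmul A B : is_laurent A -> is_laurent B -> is_laurent (lmul A B).
Proof. by move=> [a A0] [b B0]; exists (a + b); exact: val_ge_lmul. Qed.

Lemma val_ge_lconst (c : V) : val_ge 0 (lconst c).
Proof. by move=> k k0; rewrite /lconst lt_eqF. Qed.

Lemma is_laurent_lconst (c : V) : is_laurent (lconst c).
Proof. exact: val_ge_laurent (val_ge_lconst c). Qed.

Lemma lmul_lconstl (c : V) B : lmul (lconst c) B = fun k => c * B k.
Proof.
apply/funext => k; rewrite /lmul (fsum_int1 (j := 0)).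
  by rewrite /lconst eqxx subr0.
by move=> i /negPf i0; rewrite /lconst i0 mul0r.
Qed.

Lemma lmul_lconstr (c : V) B : lmul B (lconst c) = fun k => B k * c.
Proof.
apply/funext => k; rewrite /lmul (fsum_int1 (j := k)).
  by rewrite /lconst subrr eqxx.
by move=> i /negPf ik; rewrite /lconst subr_eq0 eq_sym ik mulr0.
Qed.

Lemma lmul1l B : lmul (lconst 1) B = B.
Proof. by rewrite lmul_lconstl; apply/funext => k; rewrite mul1r. Qed.

Lemma lmul1r B : lmul B (lconst 1) = B.
Proof. by rewrite lmul_lconstr; apply/funext => k; rewrite mulr1. Qed.

Lemma lmul_lconst (c d : V) : lmul (lconst c) (lconst d) = lconst (c * d).
Proof.
by rewrite lmul_lconstl; apply/funext => k; rewrite /lconst; case: eqP; rewrite ?mulr0.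
Qed.

Lemma lmulDl A B L : is_laurent A -> is_laurent B -> is_laurent L ->
  lmul (A + B) L = lmul A L + lmul B L.
Proof.
move=> [a A0] [b B0] [l L0]; apply/funext => k.
pose c : int := Num.min a b.
have A0' : val_ge c A by move=> i ic; apply: A0; lia.
have B0' : val_ge c B by move=> i ic; apply: B0; lia.
have AB0 : val_ge c (A + B) by move=> i ic; rewrite lfunD A0' ?B0' ?addr0.
have win F : val_ge c F -> lmul F L k = _ :=
  fun h => @lmul_window F L c l k (`|c| + `|k - l|)%N h L0 (leq_addr _ _) (leq_addl _ _).
rewrite lfunD !win// -big_split/=; apply: eq_bigr => i _.
by rewrite lfunD mulrDl.
Qed.

Lemma lmulDr A B L : is_laurent A -> is_laurent B -> is_laurent L ->
  lmul L (A + B) = lmul L A + lmul L B.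
Proof.
move=> [a A0] [b B0] [l L0]; apply/funext => k.
pose c : int := Num.min a b.
have A0' : val_ge c A by move=> i ic; apply: A0; lia.
have B0' : val_ge c B by move=> i ic; apply: B0; lia.
have AB0 : val_ge c (A + B) by move=> i ic; rewrite lfunD A0' ?B0' ?addr0.
have win F : val_ge c F -> lmul L F k = _ :=
  fun h => @lmul_window L F l c k (`|l| + `|k - c|)%N L0 h (leq_addr _ _) (leq_addl _ _).
rewrite lfunD !win// -big_split/=; apply: eq_bigr => i _.
by rewrite lfunD mulrDr.
Qed.

(** No Laurent condition is imposed: negation preserves the support of the summand, and when that
    support is infinite both sums take the default value 0. *)
Lemma lmulNl A L : lmul (- A) L = - lmul A L.
Proof.
apply/funext => k; rewrite lfunN /lmul.
have supp : [set: int] `&` (fun i => (- A) i * L (k - i)) @^-1` [set~ 0] =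
            [set: int] `&` (fun i => A i * L (k - i)) @^-1` [set~ 0].
  apply/seteqP; split=> i [_ /=]; rewrite lfunN mulNr => H; split=> // H'; apply: H.
    by rewrite H' oppr0.
  by rewrite -[LHS]opprK H' oppr0.
rewrite /finite_support supp -sumrN; apply: eq_bigr => i _.
by rewrite lfunN mulNr.
Qed.

Lemma lmulBl A B L : is_laurent A -> is_laurent B -> is_laurent L ->
  lmul (A - B) L = lmul A L - lmul B L.
Proof.
move=> LA LB LL; rewrite lmulDl// ?lmulNl//.
by case: LB => b B0; exists b => k kb; rewrite lfunN B0 ?oppr0.
Qed.

Lemma lmulA A B L : is_laurent A -> is_laurent B -> is_laurent L ->
  lmul A (lmul B L) = lmul (lmul A B) L.
Proof.
move=> [a A0] [b B0] [c L0]; apply/funext => k.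
have BL0 := val_ge_lmul B0 L0; have AB0 := val_ge_lmul A0 B0.
(* The outer index of (AB)L runs up to [w] in absolute value, and AB is evaluated there; the wider
   window [w2] is valid for all these inner sums at once, so the two sums can be exchanged. *)
pose w := (`|a| + `|b| + `|c| + `|k|)%N; pose w2 := (w + w + w)%N.
rewrite (@lmul_window A _ a (b + c) k w2)//; [|rewrite /w2 /w; lia..].
rewrite (@lmul_window _ L (a + b) c k w)//; [|rewrite /w; lia..].
under [RHS]eq_big_nat => i iw.
  rewrite (@lmul_window A B a b _ w2)//; [|rewrite /w2 /w; lia..].
  rewrite mulr_suml.
  over.
rewrite exchange_big/=; apply: eq_bigr => j0 _; set j : int := _ - _.
(* For j >= a, a nonzero term of the shifted inner sum has index between a + b and k - c, hence
   inside the window [w]. *)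
have [ja|aj] := ltP j a.
  by rewrite A0// mul0r big1// => i _; rewrite !mul0r.
under [RHS]eq_bigr => i _ do rewrite -mulrA.
rewrite -mulr_sumr; congr (_ * _).
have bij : bijective (fun i : int => i - j).
  by exists (+%R^~ j) => i; rewrite (subrK, addrK).
rewrite /lmul; apply: etrans.
  exact: (reindex_fsbigT _ (fun i => B i * L (k - j - i)) bij).
rewrite (@fsum_int_window _ w); last first.
  move=> i iw.
  have [ib|bi] := ltP (i - j) b; first by rewrite B0 ?mul0r.
  by rewrite L0 ?mulr0//; move: iw; rewrite /w; lia.
by apply: eq_bigr => i _; congr (_ * L _); lia.
Qed.
End LaurentTheory.

(** * Inverses of Laurent series and lowest coefficients of products *)

Section LaurentInverse.
Context {V : pzRingType}.
Implicit Types (A B L : int -> V) (k : int).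

(** A two-sided inverse is unique, so the choice made by [linv] agrees with any inverse that is
    exhibited. *)
Lemma linvE A B : is_laurent A -> is_laurent B ->
  lmul A B = lconst 1 -> lmul B A = lconst 1 -> linv A = B.
Proof.
move=> LA LB AB BA; rewrite /linv; apply: xget_unique => // B' [LB' AB' BA'].
by rewrite -[RHS]lmul1l -BA' -lmulA// AB lmul1r.
Qed.

Lemma linv_lconst (c d : V) : c * d = 1 -> d * c = 1 -> linv (lconst c) = lconst d.
Proof.
by move=> cd dc; apply: linvE; rewrite ?lmul_lconst ?cd ?dc//; exact: is_laurent_lconst.
Qed.

(** The recursion for the inverse calls on all earlier coefficients; the bound [l] makes it
    structural, the values below [l] being the intended ones. The parameter [b] stands for the
    inverse of [A 0]. *)
Fixpoint psinv_aux (A : int -> V) (b : V) (l : nat) : nat -> V :=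
  if l is l'.+1 then
    fun i => if (i < l')%N then psinv_aux A b l' i else
      b * ((i == 0)%:R - \sum_(0 <= j < i) A j.+1%:Z * psinv_aux A b l' (i - j.+1)%N)
  else fun=> 0.

Definition psinv A (b : V) : int -> V :=
  fun k => if k is Posz i then psinv_aux A b i.+1 i else 0.

Lemma psinv_auxE A (b : V) l i : (i < l)%N -> psinv_aux A b l i = psinv A b i.
Proof.
elim: l => // l IH; rewrite ltnS leq_eqVlt => /orP[/eqP -> //|il] /=.
by rewrite il IH.
Qed.

Lemma psinvE A (b : V) (i : nat) : psinv A b i =
  b * ((i == 0)%:R - \sum_(0 <= j < i) A j.+1%:Z * psinv A b (i - j.+1)%N).
Proof.
rewrite {1}/psinv /= ltnn; congr (_ * (_ - _)).
by apply: eq_big_nat => j ji; rewrite psinv_auxE//; lia.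
Qed.

Lemma val_ge_psinv A (b : V) : val_ge 0 (psinv A b).
Proof. by case. Qed.

Lemma lmulE0 A B (l : nat) : val_ge 0 A -> val_ge 0 B ->
  lmul A B l = \sum_(0 <= i < l.+1) A i * B (l - i)%N.
Proof.
move=> A0 B0; have := lmulE l A0 B0; rewrite !add0r => ->.
by apply: eq_bigr => i _; rewrite !add0r.
Qed.

Lemma psinv_right A (b : V) : val_ge 0 A -> A 0 * b = 1 ->
  lmul A (psinv A b) = lconst 1.
Proof.
move=> A0 Ab; apply/funext => -[i|i]; last first.
  by rewrite (val_ge_lmul A0 (val_ge_psinv A b)).
rewrite (lmulE0 _ A0 (val_ge_psinv A b)).
rewrite big_nat_recl// subn0 {1}psinvE mulrA Ab mul1r /=.
by rewrite subrK /lconst; case: i.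
Qed.

(** The right inverse B of A has the invertible constant term [b], hence a right inverse C of its
    own; then A = A(BC) = C, so B is two-sided even over a noncommutative ring. *)
Lemma laurent_inverse A (b : V) : val_ge 0 A -> A 0 * b = 1 -> b * A 0 = 1 ->
  exists B, [/\ val_ge 0 B, lmul A B = lconst 1 & lmul B A = lconst 1].
Proof.
move=> A0 Ab bA; pose B := psinv A b; exists B.
have B0 := val_ge_psinv A b; have AB := psinv_right A0 Ab.
have B00 : B 0 = b.
  by rewrite /B psinvE big_geq// subr0 mulr1.
have BA : B 0 * A 0 = 1 by rewrite B00.
split=> //; have BC := psinv_right B0 BA; set C := psinv B _ in BC.
have LC : is_laurent C := val_ge_laurent (val_ge_psinv B (A 0)).
have LA := val_ge_laurent A0; have LB := val_ge_laurent B0.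
suff -> : A = C by [].
by rewrite -[LHS]lmul1r -BC lmulA// AB lmul1l.
Qed.

Lemma lderiv_lmulr A (c : V) : lderiv (lmul A (lconst c)) = lmul (lderiv A) (lconst c).
Proof.
rewrite !lmul_lconstr; apply/funext => k; rewrite /lderiv.
by rewrite mulrzAl.
Qed.

Lemma lmul_val2 A B (a b : int) : val_ge a A -> val_ge b B ->
  lmul A B (a + b) = A a * B b.
Proof.
move=> A0 B0; have := lmulE 0 A0 B0.
by rewrite big_nat1 !addr0.
Qed.

Lemma lmul_val2S A B (a b : int) : val_ge a A -> val_ge b B ->
  lmul A B (a + b + 1) = A a * B (b + 1) + A (a + 1) * B b.
Proof.
move=> A0 B0; have := lmulE 1 A0 B0.
by rewrite big_nat_recl// big_nat1 !addr0.
Qed.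

Lemma lmul_val2SS A B (a b : int) : val_ge a A -> val_ge b B ->
  lmul A B (a + b + 2) =
  A a * B (b + 2) + A (a + 1) * B (b + 1) + A (a + 2) * B b.
Proof.
move=> A0 B0; have := lmulE 2 A0 B0.
by rewrite big_nat_recl// big_nat_recl// big_nat1 !addr0 addrA.
Qed.

End LaurentInverse.

Lemma lmulC (V : comPzRingType) (A B : int -> V) : lmul A B = lmul B A.
Proof.
apply/funext => k.
have bij : bijective (fun i : int => k - i) by exists (fun i => k - i) => i; rewrite subKr.
rewrite /lmul; apply: etrans.
  exact: (reindex_fsbigT _ (fun i => A i * B (k - i)) bij).
by apply: eq_fsbigr => i _; rewrite subKr mulrC.
Qed.

(** * Expansions of rational functions *)

Section Expansion.
Context {R : realType}.
Local Notation C := (Cplx R).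
Local Notation ratfun := {fraction {poly C}}.
Local Notation tofrac := (@FracField.tofrac _).
Implicit Types (p q : {poly C}) (L M : int -> C) (x : C).

Lemma val_ge_lpoly p : val_ge 0 (lpoly p).
Proof. by case. Qed.

Lemma is_laurent_lpoly p : is_laurent (lpoly p).
Proof. exact: val_ge_laurent (val_ge_lpoly p). Qed.
Hint Resolve is_laurent_lpoly : core.

Lemma lpolyD p q : lpoly (p + q) = lpoly p + lpoly q.
Proof. by apply/funext => -[k|k]; rewrite lfunD /= ?coefD ?addr0. Qed.

Lemma lpolyM p q : lpoly (p * q) = lmul (lpoly p) (lpoly q).
Proof.
apply/funext => -[k|k]; last first.
  by rewrite (val_ge_lmul (val_ge_lpoly p) (val_ge_lpoly q)).
by rewrite (lmulE0 _ (val_ge_lpoly p) (val_ge_lpoly q)) /= coefM big_mkord.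
Qed.

Lemma lpoly1 : lpoly 1 = lconst 1 :> (int -> C).
Proof. by apply/funext => -[k|k] //=; rewrite coef1 /lconst; case: k. Qed.

Lemma poly_valuation p : p != 0 ->
  exists s : nat, p`_s != 0 /\ forall k, (k < s)%N -> p`_k = 0.
Proof.
move=> p0; have ex : exists s, p`_s != 0.
  by exists (size p).-1; rewrite -lead_coefE lead_coef_eq0.
case: (ex_minnP ex) => s ps smin; exists s; split=> // k ks.
by apply/eqP/negPn/negP => /smin; rewrite leqNgt ks.
Qed.

(** The lowest nonzero coefficient of [q] is invertible, so the coefficients of [L] are forced to
    vanish one after the other from the bottom. *)
Lemma lmul_lpoly_eq0 q L : q != 0 -> is_laurent L -> lmul (lpoly q) L = 0 -> L = 0.
Proof.
move=> /poly_valuation[s [qs qlt]] [a L0] qL.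
have Q0 : val_ge (Posz s) (lpoly q) by case=> // k ks; apply: qlt.
suff H : forall l : nat, L (a + l%:Z) = 0.
  apply/funext => k; have [/L0//|ak] := ltP k a.
  by have := H `|k - a|%N; rewrite (_ : a + _ = k)//; lia.
elim/ltn_ind => l IH.
have := lmulE l Q0 L0; rewrite qL big_nat_recl// big_nat big1 => [|i il].
  rewrite addr0 addr0 subn0 /= => /esym/eqP; rewrite mulf_eq0 (negPf qs) /=.
  by move/eqP.
by rewrite IH ?mulr0//; lia.
Qed.

Lemma lmul_lpolyI q L M : q != 0 -> is_laurent L -> is_laurent M ->
  lmul (lpoly q) L = lmul (lpoly q) M -> L = M.
Proof.
move=> q0 LL LM qLM; apply/eqP; rewrite -subr_eq0; apply/eqP.
apply: (lmul_lpoly_eq0 q0); last first.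
  by rewrite lmulC lmulBl// ![lmul _ (lpoly q)]lmulC qLM subrr.
have [[a L0] [b M0]] := (LL, LM); exists (Num.min a b) => k kab.
by rewrite lfunD lfunN L0 ?M0 ?subr0//; lia.
Qed.

Lemma comp_poly_shift_eq0 q x : (q \Po ('X + x%:P) == 0) = (q == 0).
Proof. by rewrite comp_poly2_eq0// -[x]opprK polyCN size_XsubC. Qed.

Local Notation sh p x := (p \Po ('X + x%:P)).

Lemma frac_eq p q p' q' : q != 0 -> q' != 0 ->
  tofrac p / tofrac q = tofrac p' / tofrac q' -> p * q' = p' * q.
Proof.
move=> q0 q0' /eqP; rewrite eqr_div ?tofrac_eq0//.
by rewrite -!tofracM tofrac_eq => /eqP.
Qed.

(** An expansion comes with some fraction p'/q'; cross-multiplying and cancelling q' carries its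
    defining relation over to every other representation of [f]. *)
Lemma is_expansion_rep x f L p q : q != 0 -> f = tofrac p / tofrac q ->
  is_expansion x f L -> lmul (lpoly (sh q x)) L = lpoly (sh p x).
Proof.
move=> q0 -> [LL [p' [q' [q0' pq qL]]]].
have {}pq := frac_eq q0 q0' pq.
apply: (@lmul_lpolyI (sh q' x)); rewrite ?comp_poly_shift_eq0//.
  exact: is_laurent_lmul.
rewrite lmulA// -lpolyM [_ * sh q x]mulrC lpolyM -lmulA// qL -!lpolyM -!comp_polyM.
by rewrite [q * _]mulrC -pq mulrC.
Qed.

Lemma is_expansion_unique x f L M : is_expansion x f L -> is_expansion x f M -> L = M.
Proof.
move=> EL [LM [p [q [q0 fE qM]]]].
have qL := is_expansion_rep q0 fE EL; case: EL => LL _.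
by apply: (@lmul_lpolyI (sh q x)); rewrite ?comp_poly_shift_eq0// qL.
Qed.

Lemma expandE x f L : is_expansion x f L -> expand x f = L.
Proof. by move=> EL; apply: xget_unique => // M EM; exact: is_expansion_unique EM EL. Qed.

Lemma is_expansion_poly x p : is_expansion x (tofrac p) (lpoly (sh p x)).
Proof.
split=> //; exists p, 1; split; rewrite ?oner_eq0//.
  by rewrite tofrac1 divr1.
by rewrite -[1]/(1%:P) comp_polyC lpoly1 lmul1l.
Qed.

Lemma is_expansionM x f h L M :
  is_expansion x f L -> is_expansion x h M -> is_expansion x (f * h) (lmul L M).
Proof.
move=> [LL [p [q [q0 -> qL]]]] [LM [p' [q' [q0' -> qM]]]].
split; first exact: is_laurent_lmul.
exists (p * p'), (q * q'); split; rewrite ?mulf_neq0//.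
  by rewrite !tofracM invfM mulrACA.
rewrite !comp_polyM !lpolyM -qL -qM.
set P := lpoly _; set Q := lpoly _.
have [LP LQ] : is_laurent P /\ is_laurent Q by split; exact: is_laurent_lpoly.
rewrite -!lmulA//; try exact: is_laurent_lmul.
by congr (lmul P _); rewrite lmulA// (lmulC Q) -lmulA.
Qed.

Lemma is_laurentD (V : pzRingType) (A B : int -> V) :
  is_laurent A -> is_laurent B -> is_laurent (A + B).
Proof.
move=> [a A0] [b B0]; exists (Num.min a b) => k kab.
by rewrite lfunD A0 ?B0 ?addr0//; lia.
Qed.

Lemma is_expansionD x f h L M :
  is_expansion x f L -> is_expansion x h M -> is_expansion x (f + h) (L + M).
Proof.
move=> [LL [p [q [q0 -> qL]]]] [LM [p' [q' [q0' -> qM]]]].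
split; first exact: is_laurentD.
exists (p * q' + p' * q), (q * q'); split; rewrite ?mulf_neq0//.
  by rewrite tofracD !tofracM addf_div// tofrac_eq0.
rewrite comp_polyD !comp_polyM lpolyD !lpolyM -qL -qM.
rewrite lmulDr//; last exact: is_laurent_lmul.
congr (_ + _).
  by rewrite -!lmulA// [X in _ = lmul _ X]lmulC.
rewrite [lmul (lpoly _) (lpoly _)]lmulC -!lmulA//.
by rewrite [X in _ = lmul _ X]lmulC.
Qed.

Lemma is_expansion0 x : is_expansion x 0 0.
Proof.
by have := is_expansion_poly x 0; rewrite tofrac0 comp_poly0 (_ : lpoly 0 = 0)//;
  apply/funext => -[k|k] //=; rewrite coef0.
Qed.

Lemma is_expansion_sum (J : finType) x (f : J -> ratfun) (L : J -> int -> C) :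
  (forall j, is_expansion x (f j) (L j)) ->
  is_expansion x (\sum_j f j) (\sum_j L j).
Proof.
move=> fL; elim/big_ind2: _ => //; first exact: is_expansion0.
by move=> *; exact: is_expansionD.
Qed.

Lemma is_expansion_const x (c : C) : is_expansion x (tofrac c%:P) (lconst c).
Proof.
have := is_expansion_poly x c%:P; rewrite comp_polyC.
rewrite (_ : lpoly c%:P = lconst c)//; apply/funext => -[k|k] //=.
by rewrite coefC /lconst; case: k.
Qed.

Lemma is_expansionZ x f L (c : C) :
  is_expansion x f L -> is_expansion x (tofrac c%:P * f) (fun k => c * L k).
Proof.
by move=> /(is_expansionM (is_expansion_const x c)); rewrite lmul_lconstl.
Qed.

(* The expansion at x of 1 / (z - y). *)
Definition geo (x y : C) : int -> C := fun k =>
  if x == y then (k == -1)%:R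
  else if k is Posz l then (-1) ^+ l * (x - y) ^- l.+1 else 0.

Lemma val_ge_geo x y : val_ge (-1) (geo x y).
Proof.
move=> k k1; rewrite /geo; case: eqP => _; first by rewrite lt_eqF.
by case: k k1.
Qed.

Lemma val_ge_geo_neq x y : x != y -> val_ge 0 (geo x y).
Proof. by move=> /negPf xy k k0; rewrite /geo xy; case: k k0. Qed.

Lemma is_expansion_geo x y : is_expansion x (tofrac ('X - y%:P))^-1 (geo x y).
Proof.
split; first exact: val_ge_laurent (@val_ge_geo x y).
exists 1, ('X - y%:P); split; first by rewrite polyXsubC_eq0.
  by rewrite tofrac1 div1r.
rewrite -[1]/(1%:P) comp_polyC -/1 lpoly1 comp_polyB comp_polyX comp_polyC.
rewrite -addrA -polyCB lpolyD.
have -> : lpoly (x - y)%:P = lconst (x - y).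
  by apply/funext => -[k|k] //=; rewrite coefC /lconst; case: k.
have X1 : val_ge 1 (@lpoly R 'X).
  by case=> // -[|k]//= _; rewrite coefX.
rewrite lmulDl//; [|exact: is_laurent_lconst|exact: val_ge_laurent (@val_ge_geo x y)].
have XL L k : is_laurent L -> lmul (lpoly 'X) L k = L (k - 1).
  move=> LL; rewrite /lmul (fsum_int1 (j := 1)) /= ?coefX ?mul1r// => i i1.
  by case: i i1 => [[|[|i]]|i]//= _; rewrite ?coefX mul0r.
apply/funext => k; rewrite lfunD lmul_lconstl XL; last first.
  exact: val_ge_laurent (@val_ge_geo x y).
(* In each case the claim is that (x - y) geo_k + geo_(k-1) equals 1 for k = 0 and 0 otherwise. *)
rewrite /geo; have [<-|xy] := eqVneq x y.
  by rewrite subrr mul0r addr0 /lconst; case: eqP; case: eqP => //; lia.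
rewrite /lconst; case: k => [[|k]|k] /=.
- by rewrite add0r mul1r expr1 divff// subr_eq0.
- rewrite subn1 /= mulrCA [_ ^+ k.+2]exprS invfM mulVKf ?subr_eq0//.
  by rewrite [(-1) ^+ k.+1]exprS mulN1r mulNr subrr.
- by rewrite mulr0 addr0.
Qed.

End Expansion.

(** * Rational functions vanishing at infinity are determined by their polar parts *)

Section PartialFractions.
Context {R : realType} {I : finType}.
Local Notation C := (Cplx R).
Local Notation ratfun := {fraction {poly C}}.
Local Notation tofrac := (@FracField.tofrac _).
Variable xi : I -> C.
Hypothesis xi_inj : injective xi.

Let den : {poly C} := \prod_i ('X - (xi i)%:P).

Lemma den_monic K : den ^+ K \is monic.
Proof. by rewrite monic_exp// monic_prod// => i _; exact: monicXsubC. Qed.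

Lemma den_neq0 K : den ^+ K != 0.
Proof. exact: monic_neq0 (den_monic K). Qed.

(** Poles among the [xi i] and a zero at infinity. One exponent for all poles gives a common
    denominator, so sums and products stay in the class. *)
Definition proper_ratfun (f : ratfun) := exists (K : nat) (P : {poly C}),
  (size P < size (den ^+ K)%R)%N /\ f = tofrac P / tofrac (den ^+ K).

Lemma size_denD K L : size (den ^+ (K + L)) = (size (den ^+ K) + size (den ^+ L)).-1.
Proof. by rewrite exprD size_mul ?den_neq0. Qed.

Lemma size_den_gt0 K : (0 < size (den ^+ K)%R)%N.
Proof. by rewrite size_poly_gt0 den_neq0. Qed.

Lemma proper_ratfunM f h : proper_ratfun f -> proper_ratfun h -> proper_ratfun (f * h).
Proof.
move=> [K [P [sP ->]]] [L [Q [sQ ->]]]; exists (K + L)%N, (P * Q); split; last first.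
  by rewrite exprD !tofracM invfM mulrACA.
rewrite size_denD; have := size_polyMleq P Q.
by move: sP sQ (size_den_gt0 K) (size_den_gt0 L); lia.
Qed.

Lemma proper_ratfunD f h : proper_ratfun f -> proper_ratfun h -> proper_ratfun (f + h).
Proof.
move=> [K [P [sP ->]]] [L [Q [sQ ->]]].
exists (K + L)%N, (P * den ^+ L + Q * den ^+ K); split; last first.
  by rewrite exprD tofracD !tofracM addf_div// tofrac_eq0 den_neq0.
rewrite size_denD; apply: leq_ltn_trans (size_polyD _ _) _.
have := size_polyMleq P (den ^+ L); have := size_polyMleq Q (den ^+ K).
by move: sP sQ (size_den_gt0 K) (size_den_gt0 L); lia.
Qed.

Lemma proper_ratfun0 : proper_ratfun 0.
Proof.
have s0 := size_den_gt0 1.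
exists 1%N, 0; split; last by rewrite tofrac0 mul0r.
by rewrite size_poly0; exact: s0.
Qed.

Lemma proper_ratfun_sum (J : finType) (f : J -> ratfun) :
  (forall j, proper_ratfun (f j)) -> proper_ratfun (\sum_j f j).
Proof.
move=> pf; elim/big_ind: _ => // [|f1 f2]; first exact: proper_ratfun0.
exact: proper_ratfunD.
Qed.

Lemma proper_ratfunZ (c : C) f : proper_ratfun f -> proper_ratfun (tofrac c%:P * f).
Proof.
move=> [K [P [sP ->]]]; exists K, (c%:P * P); split; last by rewrite tofracM mulrA.
by rewrite mul_polyC; apply: leq_ltn_trans (size_scale_leq _ _) sP.
Qed.

Lemma proper_ratfun_inv i : proper_ratfun (tofrac ('X - (xi i)%:P))^-1.
Proof.
pose Q := \prod_(j | j != i) ('X - (xi j)%:P).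
have Q0 : Q != 0.
  by rewrite monic_neq0// monic_prod// => j _; exact: monicXsubC.
have denE : den = ('X - (xi i)%:P) * Q by rewrite /den (bigD1 i).
exists 1%N, Q; rewrite expr1 denE size_mul ?polyXsubC_eq0// size_XsubC; split.
  by [].
by rewrite tofracM invfM mulrCA divff ?tofrac_eq0// mulr1.
Qed.

(** Translating [x] to 0 turns the divisibility into the vanishing of the first [K] coefficients. *)
Lemma dvdp_XsubC_exp (P : {poly C}) (x : C) K :
  (forall k, (k < K)%N -> (P \Po ('X + x%:P))`_k = 0) ->
  ('X - x%:P) ^+ K %| P.
Proof.
move=> P0; set Q := P \Po _ in P0.
have -> : P = Q \Po ('X - x%:P).
  rewrite /Q -comp_polyA comp_polyD comp_polyX comp_polyC.
  by rewrite addrAC -addrA subrr addr0 comp_polyXr.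
have -> : Q = drop_poly K Q * 'X^K.
  rewrite -[LHS](poly_take_drop K) (_ : take_poly K Q = 0) ?add0r//.
  by apply/polyP => k; rewrite coef_take_poly coef0; case: ifP => // /P0.
by rewrite comp_polyM comp_Xn_poly dvdp_mull.
Qed.

(** Distinct points give coprime powers, so the divisibilities multiply. *)
Lemma dvdp_prod_exp (P : {poly C}) (K : nat) :
  (forall i, ('X - (xi i)%:P) ^+ K %| P) -> den ^+ K %| P.
Proof.
move=> dP; rewrite /den -prodrXl.
have : uniq (index_enum I) by exact: index_enum_uniq.
elim: (index_enum I) => [|i r IH] /=; first by rewrite big_nil dvd1p.
move=> /andP[ir ur]; rewrite big_cons Gauss_dvdp ?dP ?IH//.
rewrite prodrXl coprimep_expl// coprimep_expr// coprimep_sym coprimep_XsubC.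
rewrite -(big_map xi xpredT (fun a => 'X - a%:P)) root_prod_XsubC.
by rewrite (mem_map xi_inj).
Qed.

(** An algebraic form of Liouville's theorem: without poles, the numerator is divisible by a
    denominator of larger degree. *)
Lemma proper_ratfun_eq0 f : proper_ratfun f ->
  (forall i, exists L, is_expansion (xi i) f L /\ val_ge 0 L) -> f = 0.
Proof.
move=> [K [P [sP fE]]] fexp.
suff dP : den ^+ K %| P.
  rewrite fE; have [->|P0] := eqVneq P 0; first by rewrite tofrac0 mul0r.
  by move/(dvdp_leq P0): dP; rewrite leqNgt sP.
apply: dvdp_prod_exp => i; apply: dvdp_XsubC_exp => k kK.
have [L [EL L0]] := fexp i.
have := is_expansion_rep (den_neq0 K) fE EL.
(* The translation to [xi i] sends its own factor to ['X^K], so the translated numerator has order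
   at least [K]. *)
have -> : den ^+ K = ('X - (xi i)%:P) ^+ K * (\prod_(j | j != i) ('X - (xi j)%:P)) ^+ K.
  by rewrite -exprMn /den (bigD1 i).
rewrite comp_polyM; set U := (X in _ * X).
rewrite rmorphXn/= comp_polyB comp_polyX comp_polyC addrK lpolyM => H.
have XK : val_ge (Posz K) (@lpoly R 'X^K).
  by case=> // j jK; rewrite /= coefXn ltn_eqF.
have := val_ge_lmul XK (val_ge_lmul (@val_ge_lpoly R U) L0).
move=> /(_ (Posz k)); rewrite lmulA; last 3 first.
- exact: is_laurent_lpoly.
- exact: is_laurent_lpoly.
- exact: val_ge_laurent L0.
by rewrite H; apply; lia.
Qed.

End PartialFractions.

(** * Differentials *)

Section Differential.
Context {K : numFieldType} {V W : normedModType K}.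
Implicit Types (f h : V -> W) (x : V).

Lemma diff_littleo f x : f x = 0 ->
    (forall e : K, 0 < e -> \forall h \near (0 : V), `|f (h + x)| <= e * `|h|) ->
  differentiable f x /\ 'd f x = 0 :> (V -> W).
Proof.
move=> fx0 fo.
have H : f \o shift x = cst (f x) + (0 : V -> W) +o_ (0 : V) id.
  apply/eqaddoP => e e0; near=> h.
  rewrite /= !fctE /= fx0 addr0 subr0.
  by near: h; exact: fo.
have c0 : continuous (0 : V -> W) by move=> y; exact: cvg_cst.
have d0 : 'd f x = 0 :> (V -> W).
  pose z : {linear V -> W} := \0.
  exact: (@diff_unique _ _ _ f z x c0 H).
by split=> //; apply/diff_locallyP; rewrite d0.
Unshelve. all: by end_near.
Qed.

(** The relations of the family hold only over the polydisk while its functions are total, so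
    differentials must be computed from germs. *)
Lemma near_eq_diff f h x : (\forall y \near x, f y = h y) -> differentiable f x ->
  'd h x = 'd f x :> (V -> W).
Proof.
move=> fh df; have fhx := nbhs_singleton fh.
have [de de0] : differentiable (h - f) x /\ 'd (h - f) x = 0 :> (V -> W).
  apply: diff_littleo; first by rewrite !fctE fhx subrr.
  move=> e e0; have /nbhs0P : \forall y \near x, f y = h y by [].
  apply: filterS => y /= fhy.
  by rewrite [y + x]addrC !fctE fhy subrr normr0 mulr_ge0// ltW.
rewrite -[h in LHS](subrK f) diffD//.
by rewrite de0; apply/funext => v; exact: add0r.
Qed.

Lemma differentiable_bigsum (J : Type) (r : seq J) (P : pred J) (F : J -> V -> W) x :
  (forall j, differentiable (F j) x) ->
  differentiable (fun y => \sum_(j <- r | P j) F j y) x.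
Proof.
move=> dF; have -> : (fun y => \sum_(j <- r | P j) F j y) = \sum_(j <- r | P j) F j.
  by apply/funext => y; elim/big_ind2: _ => // a _ b _ -> ->.
by elim/big_ind: _ => // a b; exact: differentiableD.
Qed.

End Differential.

Section DifferentialScalar.
Context {K : numFieldType} {V : normedModType K}.

Lemma differentiable_bigprod (J : Type) (r : seq J) (P : pred J) (F : J -> V -> K) x :
  (forall j, differentiable (F j) x) ->
  differentiable (fun y => \prod_(j <- r | P j) F j y) x.
Proof.
move=> dF; elim: r => [|j r IH].
  under [X in differentiable X _]eq_fun do rewrite big_nil.
  exact: differentiable_cst.
under [X in differentiable X _]eq_fun do rewrite big_cons.
case: (P j) => //.
exact: (@differentiableM _ _ (F j) (fun y => \prod_(j <- r | P j) F j y)).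
Qed.

Lemma coord_norm_le m n (M : 'M[K]_(m, n)) i j : `|M i j| <= `|M|.
Proof.
rewrite [X in _ <= X]mx_normE; rewrite -[leLHS]nngE num_le.
exact: (@le_bigmax _ _ _ _ _ (i, j)).
Qed.

Lemma differentiable_mx m n (F : V -> 'M[K]_(m, n)) x :
  (forall i j, differentiable (fun y => F y i j) x) -> differentiable F x.
Proof.
move=> dF.
have -> : F = fun y => \sum_i \sum_j F y i j *: delta_mx i j.
  by apply/funext => y; exact: matrix_sum_delta.
by apply: differentiable_bigsum => i; apply: differentiable_bigsum => j;
  apply: differentiableZl.
Qed.

Lemma diff_coord m n (F : V -> 'M[K]_(m, n)) x v i j : differentiable F x ->
  'd F x v i j = 'd (fun y => F y i j) x v.
Proof.
move=> dF.
have @f : {linear 'M[K]_(m, n) -> K}.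
  by exists (fun N : 'M[K]_(_, _) => N i j); do 2![eexists]; do ?[constructor];
     rewrite ?mxE// => ? *; rewrite ?mxE//; move=> ?; rewrite !mxE.
have cf : continuous f by exact: coord_continuous.
have -> : (fun y => F y i j) = f \o F by [].
have E : 'd (f \o F) x v = 'd f (F x) ('d F x v).
  by rewrite (diff_comp dF (linear_differentiable (F x) cf)).
by rewrite E (diff_lin (F x) cf).
Qed.

Lemma differentiable_entry m n (F : V -> 'M[K]_(m, n)) x i j : differentiable F x ->
  differentiable (fun y => F y i j) x.
Proof.
by move=> dF; exact: (differentiable_comp dF (differentiable_coord (F x) i j)).
Qed.

Lemma diffM_val (f h : V -> K) x v : differentiable f x -> differentiable h x ->
  'd (f * h) x v = 'd f x v * h x + f x * 'd h x v.
Proof.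
move=> df dh; have -> : 'd (f * h) x v = f x * 'd h x v + h x * 'd f x v.
  by rewrite diffM.
by rewrite addrC [h x * _]mulrC.
Qed.

Lemma mulmxE_fun m n p (F : V -> 'M[K]_(m, n)) (G : V -> 'M[K]_(n, p)) i j :
  (fun y => (F y *m G y) i j) = \sum_k ((fun y => F y i k) * (fun y => G y k j)).
Proof.
apply/funext => y; rewrite mxE; elim/big_ind2: _ => // a a' b b'.
by rewrite !fctE => -> ->.
Qed.

Lemma differentiable_mulmx m n p (F : V -> 'M[K]_(m, n)) (G : V -> 'M[K]_(n, p)) x :
  differentiable F x -> differentiable G x -> differentiable (fun y => F y *m G y) x.
Proof.
move=> dF dG; apply: differentiable_mx => i j; rewrite mulmxE_fun.
elim/big_ind: _ => //; first by move=> a b; exact: differentiableD.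
by move=> k _; apply: differentiableM; exact: differentiable_entry.
Qed.

Lemma diff_mulmx m n p (F : V -> 'M[K]_(m, n)) (G : V -> 'M[K]_(n, p)) x v :
  differentiable F x -> differentiable G x ->
  'd (fun y => F y *m G y) x v = 'd F x v *m G x + F x *m 'd G x v.
Proof.
move=> dF dG; have dFG := differentiable_mulmx dF dG.
apply/matrixP => i j; rewrite diff_coord// mulmxE_fun !mxE -big_split/=.
have dk k : differentiable ((fun y => F y i k) * (fun y => G y k j)) x.
  by apply: differentiableM; exact: differentiable_entry.
transitivity (\sum_k 'd ((fun y => F y i k) * (fun y => G y k j)) x v).
  (* Additivity of 'd needs differentiability of the partial sums, so both are carried through the
     induction together. *)
  pose P (f : V -> K) (c : K) := differentiable f x /\ 'd f x v = c.
  suff [_ ->] : P (\sum_k ((fun y => F y i k) * (fun y => G y k j)))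
    (\sum_k 'd ((fun y => F y i k) * (fun y => G y k j)) x v) by [].
  elim/big_ind2: _ => //.
    by split => //; rewrite (diff_cst 0).
  move=> f c g e [df <-] [dg <-]; split; first exact: differentiableD.
  by rewrite diffD.
by apply: eq_bigr => k _; rewrite diffM_val ?diff_coord//; exact: differentiable_entry.
Qed.

Lemma differentiable_det n (F : V -> 'M[K]_n) x :
  differentiable F x -> differentiable (fun y => \det (F y)) x.
Proof.
move=> dF; apply: differentiable_bigsum => s.
rewrite [X in differentiable X _](_ : _ =
  (cst ((-1) ^+ s : K)) * (fun y => \prod_i F y i (s i)))//.
apply: differentiableM; first exact: differentiable_cst.
by apply: differentiable_bigprod => i; exact: differentiable_entry.
Qed.

(** [invmx] is defined by cases; Cramer's formula, its value on invertible matrices, is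
    differentiable entry by entry. *)
Lemma differentiable_invmx n (F : V -> 'M[K]_n) x : differentiable F x ->
  (\forall y \near x, F y \in unitmx) -> differentiable (fun y => (\det (F y))^-1 *: \adj (F y)) x.
Proof.
move=> dF uF; apply: differentiable_mx => i j.
have -> : (fun y => ((\det (F y))^-1 *: \adj (F y)) i j) =
  (fun y => (\det (F y))^-1) * (fun y => cofactor (F y) j i).
  by apply/funext => y; rewrite !mxE.
apply: differentiableM.
  apply: differentiableV; first exact: differentiable_det.
  by have := nbhs_singleton uF; rewrite unitmxE unitfE.
rewrite [X in differentiable X _](_ : _ =
  (cst ((-1) ^+ (j + i) : K)) * (fun y => \det (row' j (col' i (F y)))))//.
apply: differentiableM; first exact: differentiable_cst.
apply: differentiable_det; apply: differentiable_mx => k l.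
have -> : (fun y => row' j (col' i (F y)) k l) = (fun y => F y (lift j k) (lift i l)).
  by apply/funext => y; rewrite !mxE.
exact: differentiable_entry.
Qed.

Lemma differentiable_scalemx m n (s : V -> K) (F : V -> 'M[K]_(m, n)) x :
  differentiable s x -> differentiable F x -> differentiable (fun y => s y *: F y) x.
Proof.
move=> ds dF; apply: differentiable_mx => i j.
have -> : (fun y => (s y *: F y) i j) = s * (fun y => F y i j).
  by apply/funext => y; rewrite mxE.
by apply: differentiableM => //; exact: differentiable_entry.
Qed.

Lemma diff_scalemx m n (s : V -> K) (F : V -> 'M[K]_(m, n)) x v :
  differentiable s x -> differentiable F x ->
  'd (fun y => s y *: F y) x v = 'd s x v *: F x + s x *: 'd F x v.
Proof.
move=> ds dF; have dsF := differentiable_scalemx ds dF.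
apply/matrixP => i j; rewrite diff_coord//.
have -> : (fun y => (s y *: F y) i j) = s * (fun y => F y i j).
  by apply/funext => y; rewrite mxE.
by rewrite diffM_val// ?mxE ?diff_coord//; exact: differentiable_entry.
Qed.

Lemma conj_derivative n (A dA E dF : 'M[K]_n) : A \in unitmx ->
    dA *m (invmx A *m E *m A) + A *m dF = E *m dA ->
  dF = invmx A *m (E *m (dA *m invmx A) - dA *m invmx A *m E) *m A.
Proof.
move=> AU H; rewrite -[LHS](mulKmx AU) -mulmxA; congr mulmx.
rewrite -[A *m dF](addKr (dA *m (invmx A *m E *m A))) H mulmxBl addrC.
by rewrite -!mulmxA mulVmx// mulmx1.
Qed.

(** With F = g^-1 E g, differentiating g F = E g avoids a formula for the derivative of the inverse;
    Cramer's formula is needed only for the differentiability of F. *)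
Lemma diff_conj n (g : V -> 'M[K]_n) (s : V -> K) (E : 'M[K]_n) (G : V -> 'M[K]_n) x v :
    differentiable g x -> differentiable s x ->
    (\forall y \near x, g y \in unitmx) ->
    (\forall y \near x, G y = s y *: (invmx (g y) *m E *m g y)) ->
  let w := 'd g x v *m invmx (g x) in
  'd G x v = 'd s x v *: (invmx (g x) *m E *m g x)
             + s x *: (invmx (g x) *m (E *m w - w *m E) *m g x).
Proof.
move=> dg ds gU GE w.
have [F FE dF] : exists2 F : V -> 'M[K]_n,
    \forall y \near x, F y = invmx (g y) *m E *m g y & differentiable F x.
  exists (fun y => ((\det (g y))^-1 *: \adj (g y)) *m E *m g y).
    by apply: filterS gU => y yU; rewrite /invmx yU.
  apply: differentiable_mulmx => //; apply: differentiable_mulmx.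
    exact: differentiable_invmx.
  exact: differentiable_cst.
have gxU : g x \in unitmx := nbhs_singleton gU.
have FxE : F x = invmx (g x) *m E *m g x := nbhs_singleton FE.
have GF : \forall y \near x, s y *: F y = G y.
  by apply: filterS2 GE FE => y -> ->.
have dEg : differentiable (fun y => E *m g y) x.
  apply: (differentiable_mulmx (F := cst E)); [exact: differentiable_cst|exact: dg].
have EgF : \forall y \near x, E *m g y = g y *m F y.
  by apply: filterS2 gU FE => y yU ->; rewrite -!mulmxA mulKVmx.
have H : 'd g x v *m F x + g x *m 'd F x v = E *m 'd g x v.
  have E1 : 'd (fun y => E *m g y) x v = E *m 'd g x v.
    have d0 : 'd (cst E) x v = 0 by rewrite diff_cst.
    transitivity ('d (cst E) x v *m g x + E *m 'd g x v).
      exact: (diff_mulmx v (differentiable_cst E x) dg).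
    apply: etrans (congr1 (fun M => M *m g x + E *m 'd g x v) d0) _.
    by rewrite mul0mx add0r.
  have E2 := congr1 (fun h : V -> 'M[K]_n => h v) (near_eq_diff EgF dEg).
  exact: (etrans (esym (diff_mulmx v dg dF)) (etrans E2 E1)).
have E3 := congr1 (fun h : V -> 'M[K]_n => h v)
  (near_eq_diff GF (differentiable_scalemx ds dF)).
rewrite FxE in H; have {}H := conj_derivative gxU H.
apply: etrans E3 _; apply: etrans (diff_scalemx v ds dF) _.
by rewrite FxE H.
Qed.

End DifferentialScalar.

(** * Analytic functions are differentiable *)

Section AnalyticDifferentiable.
Context {R : realType} {m : nat}.
Local Notation C := (Cplx R).
Implicit Types (x y h : 'rV[C]_m).

Lemma polydisk_nbhs (c : 'rV[C]_m) (r : 'I_m -> C) y : polydisk c r y ->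
  \forall y' \near y, polydisk c r y'.
Proof.
move=> yD.
have : forall k, \forall y' \near y, `|(y' : 'rV[C]_m) 0 k - c 0 k| < r k.
  move=> k.
  have rk : 0 < r k - `|y 0 k - c 0 k| by rewrite subr_gt0; exact: yD.
  near=> y'.
  have -> : y' 0 k - c 0 k = (y' - y) 0 k + (y 0 k - c 0 k).
    by rewrite !mxE addrA subrK.
  apply: le_lt_trans (ler_normD _ _) _; rewrite -ltrBrDr.
  apply: le_lt_trans (coord_norm_le _ _ _) _.
  rewrite -normrN opprB.
  near: y'; have /cvgrPdist_lt := @cvg_id _ (nbhs y); exact.
by move=> /filter_forall.
Unshelve. all: by end_near.
Qed.

Definition psum (c : {ffun 'I_m -> nat} -> C) (k : nat) (h : 'rV[C]_m) : C :=
  \sum_(e : {ffun 'I_m -> 'I_k}) c [ffun j => e j : nat] * \prod_j h 0 j ^+ e j.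

(** Multi-indices with all entries below 2 are the same at every rank, up to the widening and
    narrowing of ordinals by [up] and [down]. *)
Lemma psum2 (c : {ffun 'I_m -> nat} -> C) k h : (2 <= k)%N ->
  \sum_(e : {ffun 'I_m -> 'I_k} | [forall j, (e j < 2)%N])
     c [ffun j => e j : nat] * \prod_j h 0 j ^+ e j = psum c 2 h.
Proof.
move=> k2.
pose up (e : {ffun 'I_m -> 'I_2}) : {ffun 'I_m -> 'I_k} :=
  [ffun j => widen_ord k2 (e j)].
pose down (e : {ffun 'I_m -> 'I_k}) : {ffun 'I_m -> 'I_2} := [ffun j => inord (e j)].
rewrite (reindex_onto up down) => [|e /forallP e2]; last first.
  by apply/ffunP => j; rewrite !ffunE; apply/val_inj; rewrite /= inordK.
apply: eq_big => [e|e _].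
  have -> : [forall j, (up e j < 2)%N] by apply/forallP => j; rewrite ffunE /= ltn_ord.
  by apply/eqP/ffunP => j; rewrite !ffunE /= inord_val.
congr (c _ * _); first by apply/ffunP => j; rewrite !ffunE.
by apply: eq_bigr => j _; rewrite ffunE.
Qed.

(* Outside the box [e < 2] a monomial has degree at least 2, so the partial sums
   differ from the one of rank 2 by O(|h|^2), uniformly in the rank. *)
Lemma psum_bound (c : {ffun 'I_m -> nat} -> C) (r M : C) k h :
    0 < r -> (2 <= k)%N -> `|h| <= r ->
    \sum_(e : {ffun 'I_m -> 'I_k})
      `|c [ffun j => e j : nat]| * \prod_j r ^+ e j <= M ->
  `|psum c k h - psum c 2 h| <= (`|h| / r) ^+ 2 * M.
Proof.
move=> r0 k2 hr cM; set t := `|h| / r.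
have t0 : 0 <= t by rewrite divr_ge0// ltW.
have t1 : t <= 1 by rewrite ler_pdivrMr// mul1r.
rewrite -(psum2 c h k2) /psum (bigID (fun e : {ffun 'I_m -> 'I_k} => [forall j, (e j < 2)%N]))/=.
rewrite addrAC subrr add0r; apply: le_trans (ler_norm_sum _ _ _) _.
apply: le_trans (ler_wpM2l _ cM); last exact: exprn_ge0.
rewrite mulr_sumr big_mkcond; apply: ler_sum => e _.
have rp : 0 <= \prod_j r ^+ e j by apply: prodr_ge0 => j _; rewrite exprn_ge0// ltW.
case: ifPn => [|_]; last by apply: mulr_ge0; [exact: exprn_ge0|exact: mulr_ge0].
rewrite negb_forall => /existsP[j0]; rewrite -leqNgt => ej0.
rewrite normrM mulrCA ler_wpM2l// normr_prod.
apply: (@le_trans _ _ (\prod_j (t ^+ e j * r ^+ e j))).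
  apply: ler_prod => j _; rewrite normr_ge0/= normrX -exprMn divfK ?gt_eqF//.
  by rewrite lerXn2r ?nnegrE// coord_norm_le.
rewrite big_split/= ler_wpM2r// (bigD1 j0)//=.
apply: (@le_trans _ _ (t ^+ e j0 * 1)).
  rewrite ler_wpM2l ?exprn_ge0//; apply: prodr_ile1 => j _.
  by rewrite exprn_ge0// exprn_ile1.
by rewrite mulr1 ler_wiXn2l.
Qed.

Lemma analytic_at_differentiable (f : 'rV[C]_m -> C) x :
  analytic_at f x -> differentiable f x.
Proof.
move=> [c [r [M [r0 cM cf]]]].
have M0 : 0 <= M.
  by apply: le_trans (cM 0%N); apply: sumr_ge0 => e _;
    rewrite mulr_ge0// prodr_ge0// => j _; rewrite exprn_ge0// ltW.
(* This polynomial need not be affine, but it is differentiable and contains all terms of degree at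
   most 1, so the remainder is quadratic. *)
pose T y := psum c 2 (y - x).
have dT : differentiable T x.
  apply: differentiable_bigsum => e.
  rewrite [X in differentiable X _](_ : _ =
    (cst (c [ffun j => e j : nat])) * (fun y : 'rV[C]_m => \prod_j (y - x) 0 j ^+ e j)); last by [].
  apply: differentiableM; first exact: differentiable_cst.
  apply: differentiable_bigprod => j.
  rewrite [X in differentiable X _](_ : _ = (fun y : 'rV[C]_m =>
    \prod_(i < e j) ((fun z : 'rV[C]_m => z 0 j) - cst (x 0 j)) y)); last first.
    by apply/funext => y; rewrite prodr_const card_ord !fctE !mxE.
  apply: differentiable_bigprod => i.
  apply: differentiableB; last exact: differentiable_cst.
  exact: differentiable_coord.
have cvgf y : `|y - x| < r -> psum c ^~ (y - x) @ \oo --> f y.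
  move=> yx.
  rewrite [X in X @ _](_ : _ = (fun k : nat => \sum_(e : {ffun 'I_m -> 'I_k})
          c [ffun j => e j : nat] * \prod_j (y 0 j - x 0 j) ^+ e j)).
    apply: cf => k.
    by apply: le_lt_trans yx; have := coord_norm_le (y - x) 0 k; rewrite !mxE.
  apply/funext => k; apply: eq_bigr => e _; congr (_ * _).
  by apply: eq_bigr => j _; rewrite !mxE.
have bound y : `|y - x| < r -> `|f y - T y| <= (`|y - x| / r) ^+ 2 * M.
  move=> yx; apply/ler_addgt0Pr => e e0.
  have /cvgrPdist_lt/(_ _ e0) := cvgf y yx.
  move=> /(filterI (nbhs_infty_ge 2)) /filter_ex [k [/= k2 ke]].
  rewrite -(subrK (psum c k (y - x)) (f y)) -addrA addrC.
  apply: le_trans (ler_normD _ _) _; apply: lerD; last exact: ltW.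
  by apply: psum_bound => //; exact: ltW.
have fx : f x = T x.
  have := bound x; rewrite subrr normr0 mul0r expr0n /= mul0r => /(_ r0).
  by rewrite normr_le0 subr_eq0 => /eqP.
rewrite -[f](subrK T); apply: (differentiableD _ dT).
suff [] : differentiable (f - T) x /\ 'd (f - T) x = 0 :> (_ -> _) by [].
apply: diff_littleo.
  by rewrite !fctE fx subrr.
have near0 (d : C) : 0 < d -> \forall h \near (0 : 'rV[C]_m), `|h| < d.
  move=> d0; have /cvgrPdist_lt/(_ _ d0) := @cvg_id _ (nbhs (0 : 'rV[C]_m)).
  by apply: filterS => h; rewrite sub0r normrN.
move=> e e0; near=> h.
have hr : `|h| < r by near: h; exact: near0.
have := bound (h + x); rewrite addrK => /(_ hr).
move=> /le_trans; apply.
(* Obtained by solving |h|^2 (M + 1) / r^2 <= e |h| for |h|; M + 1 replaces M because M may be 0. *)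
have hd : `|h| < e * (r ^+ 2 / (M + 1)).
  near: h; apply: near0; rewrite mulr_gt0// divr_gt0 ?exprn_gt0//.
  by rewrite ltr_wpDl.
have M1 : 0 < M + 1 by rewrite ltr_wpDl.
have r2 : 0 < r ^+ 2 by rewrite exprn_gt0.
apply: (@le_trans _ _ (`|h| * (`|h| * ((M + 1) / r ^+ 2)))).
  rewrite expr_div_n expr2 -!mulrA ler_wpM2l// ler_wpM2l// [leLHS]mulrC.
  by rewrite ler_wpM2r ?invr_ge0 ?(ltW r2)// lerDl.
rewrite [leRHS]mulrC ler_wpM2l// -ler_pdivlMr; last by rewrite divr_gt0.
by rewrite invf_div ltW.
Unshelve. all: by end_near.
Qed.

End AnalyticDifferentiable.

(** * The Iwahori Lie algebra *)

Section MatrixFacts.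
Context {R : realType} {n : nat}.
Local Notation C := (Cplx R).
Implicit Types (A B M u g : 'M[C]_n).
Local Notation N' := (@matN R n)^T.
Local Notation E' := (@matE R n)^T.

Lemma lie_u0 : lie_u (0 : 'M[C]_n).
Proof. by move=> i j _; rewrite mxE. Qed.

Lemma lie_uD A B : lie_u A -> lie_u B -> lie_u (A + B).
Proof. by move=> uA uB i j ij; rewrite mxE uA ?uB ?addr0. Qed.

Lemma lie_uZ (c : C) A : lie_u A -> lie_u (c *: A).
Proof. by move=> uA i j ij; rewrite mxE uA ?mulr0. Qed.

Lemma lie_uN A : lie_u A -> lie_u (- A).
Proof. by move=> uA i j ij; rewrite mxE uA ?oppr0. Qed.

Lemma lie_uB A B : lie_u A -> lie_u B -> lie_u (A - B).
Proof. by move=> uA uB; apply: lie_uD => //; apply: lie_uN. Qed.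

Lemma lie_uM A B : lie_u A -> lie_u B -> lie_u (A *m B).
Proof.
move=> uA uB i j ji; rewrite mxE big1// => k _.
have [ki|ik] := leqP k i; first by rewrite uA ?mul0r.
by rewrite uB ?mulr0//; lia.
Qed.

Lemma lie_u_mulr_matE u : lie_u u -> u *m E' = 0.
Proof.
move=> uu; apply/matrixP => i j; rewrite !mxE big1// => k _; rewrite !mxE.
have [k0|] := eqVneq (k : nat) 0%N; last by rewrite andbF mulr0.
by rewrite uu ?mul0r// k0.
Qed.

Lemma lie_u_mull_matE u : lie_u u -> E' *m u = 0.
Proof.
move=> uu; apply/matrixP => i j; rewrite !mxE big1// => k _; rewrite !mxE.
have [kn|] := eqVneq k.+1 n; last by rewrite mul0r.
by rewrite uu ?mulr0// -ltnS kn.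
Qed.

(* The columns of M are solved from the bottom row upwards. *)
Lemma lie_u_unip_mul u M : lie_u u -> lie_u ((1%:M + u) *m M) -> lie_u M.
Proof.
move=> uu uM.
suff H : forall d (i j : 'I_n), (n - i <= d)%N -> (j <= i)%N -> M i j = 0.
  by move=> i j; exact: (H n i j (leq_subr _ _)).
elim=> [|d IH] i j; first by rewrite leqn0 subn_eq0 leqNgt ltn_ord.
move=> id ji; have := uM i j ji; rewrite mulmxDl mul1mx !mxE big1 ?addr0// => k _.
have [ki|ik] := leqP k i; first by rewrite uu ?mul0r.
by rewrite IH ?mulr0//; [have := ltn_ord i; have := ltn_ord k; lia|lia].
Qed.

Lemma unip_unitmx u : lie_u u -> 1%:M + u \in unitmx.
Proof.
move=> uu; rewrite unitmxE -det_tr det_trig.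
  rewrite big1 ?unitr1// => i _; rewrite !mxE eqxx uu ?addr0//.
apply/is_trig_mxP => i j ij; rewrite !mxE uu ?addr0; last exact: ltnW.
by rewrite (_ : (j == i) = false)//; apply/negbTE; rewrite -val_eqE/= gtn_eqF.
Qed.

Lemma matHT_comm_u u : lie_u u -> lie_u (matHT *m u - u *m matHT).
Proof.
move=> uu i j ij; rewrite mul_diag_mx mul_mx_diag !mxE uu// mulr0 mul0r subrr.
by [].
Qed.

(** The constant is the first diagonal entry of H_T minus the last: (n - 1) / 2n - (1 - n) / 2n. *)
Lemma bracket_HT_matE : (0 < n)%N ->
  bracket matHT E' = ((n%:R - 1) / n%:R : C) *: E'.
Proof.
move=> n0; have n0' : n%:R != 0 :> C by rewrite pnatr_eq0 -lt0n.
apply/matrixP => i j; rewrite /bracket mul_diag_mx mul_mx_diag !mxE.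
have [jn|] := eqVneq j.+1 n; last by rewrite mulr0 mul0r mulr0 subrr.
have [i0|] := eqVneq (i : nat) 0%N; last by rewrite mulr0 mul0r mulr0 subrr.
rewrite i0 /= mulr1 mul1r mulr1 !natrM.
have -> : (j : nat)%:R = n%:R - 1 :> C.
  have : j.+1%:R = n%:R :> C by rewrite jn.
  by rewrite -addn1 natrD => <-; rewrite addrK.
by field.
Qed.

Lemma matN_mul_tr : matN *m N' + matE *m E' = 1%:M :> 'M[C]_n.
Proof.
apply/matrixP => i j; rewrite !mxE.
under eq_bigr => k _ do rewrite !mxE.
under [X in _ + X]eq_bigr => k _ do rewrite !mxE.
have n0 : (0 < n)%N by apply: leq_ltn_trans (ltn_ord i).
have [iN|Ni] := ltnP i.+1 n.
  rewrite (bigD1 (Ordinal iN))//= eqxx mul1r big1 => [|k ki]; last first.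
    rewrite (_ : (k == i.+1 :> nat) = false) ?mul0r//.
    by apply/negbTE; rewrite -val_eqE in ki.
  rewrite big1 ?addr0 => [|k _]; last by rewrite ltn_eqF// mul0r.
  by rewrite eqSS -val_eqE.
have ni : i.+1 = n by apply/eqP; rewrite eqn_leq ltn_ord Ni.
rewrite big1 ?add0r => [|k _]; last by rewrite ni ltn_eqF// mul0r.
rewrite (bigD1 (Ordinal n0))//= big1 => [|k k0]; last first.
  rewrite (_ : (k == 0 :> nat) = false) ?andbF ?mul0r//.
  by apply/negbTE; rewrite -val_eqE in k0.
rewrite !andbT addr0 ni eqxx mul1r; congr (_%:R); rewrite -val_eqE /=.
by move: ni; clear; lia.
Qed.

Lemma matN_tr_mul : N' *m matN + E' *m matE = 1%:M :> 'M[C]_n.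
Proof.
apply/matrixP => i j; rewrite !mxE.
under eq_bigr => k _ do rewrite !mxE.
under [X in _ + X]eq_bigr => k _ do rewrite !mxE.
have n1n : (n.-1 < n)%N by have := ltn_ord i; lia.
have nE : n.-1.+1 = n by rewrite prednK//; lia.
case: (posnP i) => [i0|ipos].
  rewrite big1 ?add0r => [|k _]; last by rewrite i0 mul0r.
  rewrite (bigD1 (Ordinal n1n))//= big1 => [|k k0]; last first.
    rewrite (_ : (k.+1 == n) = false) ?mul0r//.
    by apply/negbTE; rewrite -val_eqE/= -eqSS nE in k0.
  by rewrite nE eqxx /= mul1r addr0 -[i == j]val_eqE/= i0 eq_sym.
have iE : i.-1.+1 = i by rewrite prednK.
have i1 : (i.-1 < n)%N by have := ltn_ord i; lia.
rewrite [X in _ + X]big1 ?addr0 => [|k _].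
  rewrite (bigD1 (Ordinal i1))//= iE eqxx mul1r big1 ?addr0 => [|k k0].
    by rewrite eq_sym -val_eqE.
  rewrite (_ : (i == k.+1 :> nat) = false) ?mul0r//.
  by apply/negbTE; rewrite -val_eqE/= -eqSS iE eq_sym in k0.
by rewrite andbF mul0r.
Qed.

Lemma matN_mul_matE_tr : matN *m E' = 0 :> 'M[C]_n.
Proof.
apply/matrixP => i j; rewrite !mxE big1// => k _; rewrite !mxE.
by have [->|] := eqVneq (k : nat) i.+1; rewrite ?andbF ?mulr0 ?mul0r.
Qed.

Lemma matN_tr_mul_matE : N' *m matE = 0 :> 'M[C]_n.
Proof.
apply/matrixP => i j; rewrite !mxE big1// => k _; rewrite !mxE.
have [ik|] := eqVneq (i : nat) k.+1; last by rewrite mul0r.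
by rewrite ltn_eqF ?mulr0// -ik.
Qed.

Definition varpi_inv : int -> 'M[C]_n := lconst N' + zshift (-1) (lconst E').

Lemma varpi_invE k : varpi_inv k = (if k == 0 then N' else 0) + (if k == -1 then E' else 0).
Proof. by rewrite /varpi_inv lfunD /zshift /lconst opprK addr_eq0. Qed.

Lemma val_ge_varpi_inv : val_ge (-1) varpi_inv.
Proof. by move=> k k1; rewrite varpi_invE !lt_eqF// ?addr0//; lia. Qed.

(** In either product the cross terms, of degrees 1 and -1, vanish, and the two remaining terms are
    complementary diagonal idempotents. *)
Lemma linv_varpi : linv varpi = varpi_inv.
Proof.
have v0 : val_ge 0 (@varpi R n).
  by move=> k k0; rewrite /varpi lfunD /zshift /lconst !lt_eqF ?addr0//; lia.
have LE (c : 'M[C]_n) r : is_laurent (zshift r (lconst c)).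
  by exists r => k kr; rewrite /zshift /lconst lt_eqF//; lia.
have LC (c : 'M[C]_n) := is_laurent_lconst c.
have sl (c d : 'M[C]_n) r : lmul (lconst c) (zshift r (lconst d)) = zshift r (lconst (c * d)).
  by rewrite lmul_lconstl; apply/funext => k; rewrite /zshift /lconst; case: eqP; rewrite ?mulr0.
have sr (c d : 'M[C]_n) r : lmul (zshift r (lconst c)) (lconst d) = zshift r (lconst (c * d)).
  by rewrite lmul_lconstr; apply/funext => k; rewrite /zshift /lconst; case: eqP; rewrite ?mul0r.
have ss (c d : 'M[C]_n) (r : int) :
    lmul (zshift r (lconst c)) (zshift (- r) (lconst d)) = lconst (c * d).
  apply/funext => k; rewrite /lmul (fsum_int1 (j := r)).
    rewrite /zshift /lconst subrr eqxx opprK subrK; case: eqP => //; rewrite mulr0//.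
  by move=> i /negPf ir; rewrite /zshift /lconst subr_eq0 ir mul0r.
have z0 r : zshift r (lconst (0 : 'M[C]_n)) = 0.
  by apply/funext => k; rewrite /zshift /lconst; case: eqP.
have lD (c d : 'M[C]_n) : lconst (c + d) = lconst c + lconst d.
  by apply/funext => k; rewrite lfunD /lconst; case: eqP; rewrite ?addr0.
have EN : matE *m N' = 0 :> 'M[C]_n.
  by apply: trmx_inj; rewrite trmx_mul trmxK matN_mul_matE_tr trmx0.
have EN' : E' *m matN = 0 :> 'M[C]_n.
  by apply: trmx_inj; rewrite trmx_mul trmxK matN_tr_mul_matE trmx0.
apply: linvE; rewrite /varpi /varpi_inv; try exact: is_laurentD.
  rewrite lmulDl//; last exact: is_laurentD.
  rewrite !lmulDr// lmul_lconst sl sr ss.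
  rewrite -![_ * _]/(_ *m _) matN_mul_matE_tr EN !z0 addr0 add0r -lD.
  by rewrite matN_mul_tr.
rewrite lmulDl//; last exact: is_laurentD.
rewrite !lmulDr// lmul_lconst sl sr -[X in lmul _ (zshift X _)]opprK ss.
rewrite -![_ * _]/(_ *m _) matN_tr_mul_matE EN' !z0 addr0 add0r -lD.
by rewrite matN_tr_mul.
Qed.

Lemma bracketDl A B M : bracket (A + B) M = bracket A M + bracket B M.
Proof. by rewrite /bracket mulmxDl mulmxDr opprD addrACA. Qed.

Lemma bracketC A B : bracket A B = - bracket B A.
Proof. by rewrite /bracket opprB. Qed.

Lemma bracketDr A B M : bracket M (A + B) = bracket M A + bracket M B.
Proof. by rewrite bracketC bracketDl opprD -!bracketC. Qed.

Lemma bracketZl (c : C) A B : bracket (c *: A) B = c *: bracket A B.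
Proof. by rewrite /bracket scalerBr scalemxAl scalemxAr. Qed.

Lemma bracketZr (c : C) A B : bracket A (c *: B) = c *: bracket A B.
Proof. by rewrite bracketC bracketZl -scalerN -bracketC. Qed.

Lemma bracketNr A B : bracket A (- B) = - bracket A B.
Proof. by rewrite -scaleN1r bracketZr scaleN1r. Qed.

Lemma bracketNl A B : bracket (- A) B = - bracket A B.
Proof. by rewrite -scaleN1r bracketZl scaleN1r. Qed.

Lemma bracketAA A : bracket A A = 0.
Proof. exact: subrr. Qed.

Lemma bracket_suml (J : finType) (P : pred J) (F : J -> 'M[C]_n) B :
  bracket (\sum_(j | P j) F j) B = \sum_(j | P j) bracket (F j) B.
Proof. by rewrite /bracket mulmx_suml mulmx_sumr -sumrB. Qed.

Lemma bracket_sumr (J : finType) (P : pred J) (F : J -> 'M[C]_n) B :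
  bracket B (\sum_(j | P j) F j) = \sum_(j | P j) bracket B (F j).
Proof. by rewrite bracketC bracket_suml -sumrN; apply: eq_bigr => j _; rewrite -bracketC. Qed.

Lemma AdmD g A B : Adm g (A + B) = Adm g A + Adm g B.
Proof. by rewrite /Adm mulmxDr mulmxDl. Qed.

Lemma AdmZ g (c : C) A : Adm g (c *: A) = c *: Adm g A.
Proof. by rewrite /Adm -scalemxAr -scalemxAl. Qed.

Lemma AdmN g A : Adm g (- A) = - Adm g A.
Proof. by rewrite -scaleN1r AdmZ scaleN1r. Qed.

Lemma AdmB g A B : Adm g (A - B) = Adm g A - Adm g B.
Proof. by rewrite AdmD AdmN. Qed.

Lemma AdmM g A B : g \in unitmx -> Adm g (A *m B) = Adm g A *m Adm g B.
Proof. by move=> gU; rewrite /Adm !mulmxA mulmxKV. Qed.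

Lemma Adm_bracket g A B : g \in unitmx -> Adm g (bracket A B) = bracket (Adm g A) (Adm g B).
Proof. by move=> gU; rewrite /bracket AdmB !AdmM. Qed.

Lemma AdmK g : g \in unitmx -> cancel (Adm g) (Adm (invmx g)).
Proof. by move=> gU A; rewrite /Adm invmxK !mulmxA mulVmx// mul1mx mulmxKV. Qed.

Lemma AdmVK g : g \in unitmx -> cancel (Adm (invmx g)) (Adm g).
Proof. by move=> gU A; rewrite /Adm invmxK !mulmxA mulmxV// mul1mx mulmxK. Qed.

Lemma Adm_sum (J : finType) (P : pred J) (F : J -> 'M[C]_n) g :
  Adm g (\sum_(j | P j) F j) = \sum_(j | P j) Adm g (F j).
Proof. by rewrite /Adm mulmx_sumr mulmx_suml. Qed.

Lemma invmxM g h : g \in unitmx -> h \in unitmx ->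
  invmx (g *m h) = invmx h *m invmx g.
Proof.
move=> gU hU; have U : g *m h \in unitmx by rewrite unitmx_mul gU.
by rewrite -[RHS](mulKmx U) -[(g *m h) *m _]mulmxA mulKVmx// mulmxV// mulmx1.
Qed.

Lemma Adm_mulmx g h A : g \in unitmx -> h \in unitmx -> Adm (g *m h) A = Adm g (Adm h A).
Proof. by move=> gU hU; rewrite /Adm invmxM// !mulmxA. Qed.

End MatrixFacts.

(** * Partial fractions of the connection matrix *)

Section Geo2.
Context {R : realType}.
Local Notation C := (Cplx R).
Implicit Types x y : C.

(** The expansion at x of 1 / (z - y)^2. *)
Definition geo2 x y : int -> C := lmul (geo x y) (geo x y).

Lemma geoxx x k : geo x x k = (k == -1)%:R.
Proof. by rewrite /geo eqxx. Qed.

Lemma geo2xx x k : geo2 x x k = (k == -2)%:R.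
Proof.
rewrite /geo2 /lmul (fsum_int1 (j := -1)).
  rewrite !geoxx eqxx mul1r; congr ((_ : bool)%:R); lia.
by move=> i /negPf i1; rewrite geoxx i1 mul0r.
Qed.

Lemma geo_neg x y k : x != y -> k < 0 -> geo x y k = 0.
Proof. by move=> xy; exact: val_ge_geo_neq. Qed.

Lemma geo2_neg x y k : x != y -> k < 0 -> geo2 x y k = 0.
Proof.
move=> xy k0; have H := val_ge_geo_neq xy.
by rewrite /geo2 (val_ge_lmul H H).
Qed.

Lemma geo_0 x y : x != y -> geo x y 0 = (x - y)^-1.
Proof. by move=> /negPf xy; rewrite /geo xy /= mul1r. Qed.

Lemma geo_1 x y : x != y -> geo x y 1 = - (x - y) ^- 2.
Proof. by move=> /negPf xy; rewrite /geo xy /= expr1 mulN1r. Qed.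

Lemma geo2_0 x y : x != y -> geo2 x y 0 = (x - y) ^- 2.
Proof.
move=> xy; have H := val_ge_geo_neq xy.
by have := lmul_val2 H H; rewrite addr0 => E; rewrite /geo2 E geo_0// expr2 invfM.
Qed.

End Geo2.

Section FamilyExpansion.
Context {R : realType} {I : finType}.
Local Notation C := (Cplx R).
Local Notation ratfun := {fraction {poly C}}.
Local Notation tofrac := (@FracField.tofrac _).
Variable xi : I -> C.
Hypothesis xi_inj : injective xi.
Local Notation z j := (tofrac ('X - (xi j)%:P)).

(** Cross-multiplying the two fractions for [f] transports the degree gap at infinity. Zero
    numerators are split off because degrees add only for nonzero polynomials. *)
Lemma proper_regular (f : ratfun) (K : nat) (P : {poly C}) :
  f = (\prod_i z i) ^- K * tofrac P -> regular_at_infty f -> proper_ratfun xi f.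
Proof.
move=> fE [p [q [q0 fE' spq]]].
pose den := \prod_i ('X - (xi i)%:P).
have fE'' : f = tofrac P / tofrac (den ^+ K).
  by rewrite fE mulrC tofracXn (rmorph_prod (@FracField.tofrac {poly C})).
exists K, P; split=> //.
have den0 : den ^+ K != 0 := den_neq0 xi K.
have := frac_eq den0 q0 (etrans (esym fE'') fE') => /(congr1 (size : {poly C} -> nat)).
have [->|P0] := eqVneq P 0; first by move=> _; rewrite size_poly0 size_poly_gt0.
have [->|p0] := eqVneq p 0.
  rewrite mul0r size_poly0 => /eqP; rewrite size_poly_eq0 mulf_eq0.
  by rewrite (negPf P0) (negPf q0).
rewrite !size_mul//; move: P0 p0 q0 den0 spq; rewrite -!size_poly_gt0.
have arith (sP sp sq sd : nat) : (0 < sP -> 0 < sp -> 0 < sq -> 0 < sd ->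
  sp <= sq.-2 -> (sP + sq).-1 = (sp + sd).-1 -> sP < sd)%N by lia.
exact: arith.
Qed.

(** [expand] is a chosen value, meaningful only once some expansion exists; one is assembled from
    the numerator and from geometric series. *)
Lemma proper_expandable (f : ratfun) (x : C) : proper_ratfun xi f ->
  is_expansion x f (expand x f).
Proof.
move=> [K [P [_ fE]]].
suff [L EL] : exists L, is_expansion x f L by rewrite (expandE EL).
have mulE (u w : ratfun) : (exists L, is_expansion x u L) ->
    (exists L, is_expansion x w L) -> exists L, is_expansion x (u * w) L.
  by move=> [L EL] [M EM]; exists (lmul L M); exact: is_expansionM.
have -> : f = tofrac P * \prod_(k < K) \prod_i (z i)^-1.
  rewrite fE tofracXn (rmorph_prod (@FracField.tofrac {poly C})) prodfV.
  by rewrite prodr_const card_ord exprVn.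
have E1 : exists L, is_expansion x 1 L.
  by exists (lconst 1); rewrite -tofrac1; exact: is_expansion_const.
apply: (mulE); first by exists (lpoly (P \Po ('X + x%:P))); exact: is_expansion_poly.
apply: (big_ind (fun u => exists L, is_expansion x u L)) => // k _.
apply: (big_ind (fun u => exists L, is_expansion x u L)) => // i _.
by exists (geo x (xi i)); exact: is_expansion_geo.
Qed.

Definition pfrac (A B : I -> C) : ratfun :=
  \sum_j (tofrac (A j)%:P * ((z j)^-1 * (z j)^-1) + tofrac (B j)%:P * (z j)^-1).

Lemma is_expansion_pfrac (x : C) (A B : I -> C) :
  is_expansion x (pfrac A B)
    (\sum_j ((fun k => A j * geo2 x (xi j) k) + (fun k => B j * geo x (xi j) k))).
Proof.
apply: is_expansion_sum => j; apply: is_expansionD.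
  by apply: is_expansionZ; apply: is_expansionM; exact: is_expansion_geo.
by apply: is_expansionZ; exact: is_expansion_geo.
Qed.

Lemma sum_funE (V : pzRingType) (J : finType) (F : J -> int -> V) k :
  (\sum_j F j) k = \sum_j F j k.
Proof. by elim/big_ind2: _ => // a b a' b' <- <-. Qed.

Lemma expand_pfrac (x : C) (A B : I -> C) k :
  expand x (pfrac A B) k = \sum_j (A j * geo2 x (xi j) k + B j * geo x (xi j) k).
Proof. by rewrite (expandE (is_expansion_pfrac x A B)) sum_funE. Qed.

Lemma proper_pfrac (A B : I -> C) : proper_ratfun xi (pfrac A B).
Proof.
apply: proper_ratfun_sum => j; apply: proper_ratfunD; apply: proper_ratfunZ.
  by apply: proper_ratfunM; exact: proper_ratfun_inv.
exact: proper_ratfun_inv.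
Qed.

(** The difference of the two sides vanishes at infinity and has no pole left, hence is zero. *)
Lemma proper_pfracE (f : ratfun) : proper_ratfun xi f ->
    (forall i, val_ge (-2) (expand (xi i) f)) ->
  f = pfrac (fun j => expand (xi j) f (-2)) (fun j => expand (xi j) f (-1)).
Proof.
move=> pf f2; set g := pfrac _ _; apply/eqP; rewrite -subr_eq0; apply/eqP.
have gN : - g = tofrac (-1)%:P * g by rewrite polyCN tofracN tofrac1 mulN1r.
apply: (proper_ratfun_eq0 xi_inj).
  by apply: proper_ratfunD => //; rewrite gN; apply: proper_ratfunZ; exact: proper_pfrac.
move=> i; have Ef := proper_expandable (xi i) pf.
have Eg := is_expansion_pfrac (xi i) (fun j => expand (xi j) f (-2))
  (fun j => expand (xi j) f (-1)).
eexists; split; first by rewrite gN; exact: is_expansionD Ef (is_expansionZ (-1) Eg).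
move=> k k0; rewrite lfunD sum_funE (bigD1 i)//= big1 => [|j ji]; last first.
  have xij : xi i != xi j by rewrite inj_eq// eq_sym.
  by rewrite lfunD geo2_neg// geo_neg// !mulr0 addr0.
rewrite lfunD geo2xx geoxx addr0 mulN1r.
have [->|k1] := eqVneq k (-1); first by rewrite mulr0 add0r mulr1 subrr.
rewrite mulr0 addr0; have [->|k2] := eqVneq k (-2); first by rewrite mulr1 subrr.
by rewrite mulr0 oppr0 addr0 f2//; lia.
Qed.

End FamilyExpansion.

Section FamilyMatrix.
Context {R : realType} {I : finType} {n : nat}.
Local Notation C := (Cplx R).
Local Notation ratfun := {fraction {poly C}}.
Local Notation tofrac := (@FracField.tofrac _).
Variable xi : I -> C.
Hypothesis xi_inj : injective xi.
Local Notation z j := (tofrac ('X - (xi j)%:P)).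

Lemma principal_part_simple (x : C) (L : int -> 'M[C]_n) :
  val_ge (-1) L ->
  principal_part x L = (tofrac ('X - x%:P))^-1 *:
      map_mx (fun c => tofrac c%:P) (L (-1)).
Proof.
move=> L1; rewrite /principal_part (fsbigE [:: 1%N])//=.
- by rewrite big_mkcond big_seq1 mem_set//= expr1.
- by move=> k; rewrite /= inE => /eqP ->.
move=> k k0; rewrite inE => k1; rewrite L1; last by lia.
by apply/matrixP => i j; rewrite !mxE tofrac0 mulr0.
Qed.

Lemma expand_mx_simple_poles (x : C) (B : I -> 'M[C]_n) k :
  expand_mx x (\sum_j (z j)^-1 *: map_mx (fun c => tofrac c%:P) (B j)) k =
  \sum_j geo x (xi j) k *: B j.
Proof.
apply/matrixP => a b; rewrite !mxE.
have -> : (\sum_j (z j)^-1 *: map_mx (fun c => tofrac c%:P) (B j)) a b =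
    pfrac xi (fun=> 0) (fun j => B j a b).
  rewrite summxE; apply: eq_bigr => j _.
  by rewrite !mxE tofrac0 mul0r add0r mulrC.
rewrite expand_pfrac summxE; apply: eq_bigr => j _.
by rewrite mxE mul0r add0r mulrC.
Qed.

Lemma expand_mx_proper (M : 'M[ratfun]_n) :
    (forall a b, proper_ratfun xi (M a b)) ->
    (forall i, val_ge (-2) (expand_mx (xi i) M)) ->
  forall x k, expand_mx x M k =
    \sum_j (geo2 x (xi j) k *: expand_mx (xi j) M (-2) +
            geo x (xi j) k *: expand_mx (xi j) M (-1)).
Proof.
move=> pM M2 x k; apply/matrixP => a b; rewrite mxE.
rewrite [M a b in LHS](proper_pfracE xi_inj (pM a b)).
  rewrite expand_pfrac summxE; apply: eq_bigr => j _.
  by rewrite !mxE; congr (_ + _); exact: mulrC.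
by move=> i l l2; have := congr1 (fun A : 'M[C]_n => A a b) (M2 i l l2); rewrite !mxE.
Qed.

End FamilyMatrix.

(** * The normalized formal type *)

Section MatrixIdentities.
Context {F : fieldType} {n : nat}.
Implicit Types (A B D G H M N P Q S X : 'M[F]_n) (a t : F).

Lemma leading_residueE a t M H D X :
  - (a * t) *: M + (H - t *: (D + X)) = H - t *: (a *: M + D + X).
Proof. by apply/matrixP => i j; rewrite !mxE; ring. Qed.

(** The degree 0 coefficient of p G = a varpi^-1 p, with P, Q the first two coefficients of p, M
    that of G in degree 0 when P G = P M, and A, N standing for E', N'. *)
Lemma commutator_scaled a A G M N P Q :
    P *m G + Q *m (a *: A) = a *: A *m Q + a *: N *m P ->
  P *m G = a *: (N *m P + A *m Q - Q *m A).
Proof.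
move=> E; rewrite -[LHS](addrK (Q *m (a *: A))) E -!scalemxAl -scalemxAr.
by rewrite -scalerDr -scalerBr [X in X - _]addrC.
Qed.

(** The degree -1 coefficient of p B - p' = T p, rearranged: P, Q are the first two coefficients of
    p, S is the residue of B, and t stands for a / n. *)
Lemma commutator_equation t A H M P Q S :
    P *m S + Q *m (- t *: A) = (- t *: A) *m Q + (- t *: M + H) *m P ->
  P *m S - t *: (Q *m A) = - t *: (A *m Q) + (H - t *: M) *m P.
Proof.
by rewrite -scalemxAr -scalemxAl !scaleNr => ->; rewrite [H - _]addrC.
Qed.

Lemma commutator_solve t A B M P Q : P - t *: Q = - t *: B + (M - t *: A) ->
  t *: (A + B - Q) = M - P.
Proof.
move=> E; have -> : P = - t *: B + (M - t *: A) + t *: Q by rewrite -E subrK.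
by apply/matrixP => i j; rewrite !mxE; ring.
Qed.

Lemma commutator_divide a t A D H M N X : a != 0 -> t != 0 ->
    (a / t) *: A = M - (H - t^-1 *: (a *: N + D + X)) ->
  A = (t / a) *: (M - H) + (N + a^-1 *: D) + a^-1 *: X.
Proof.
move=> a0 t0 E; rewrite -[A](scalerK (a := a / t)) ?mulf_neq0 ?invr_neq0// E.
by apply/matrixP => i j; rewrite !mxE; field; rewrite a0.
Qed.

End MatrixIdentities.

Lemma Ad_linv (V : pzRingType) (p q F : int -> V) : is_laurent p -> is_laurent q ->
    lmul p q = lconst 1 -> lmul q p = lconst 1 ->
  Ad (linv p) F = lmul (lmul q F) p.
Proof.
by move=> Lp Lq pq qp; rewrite /Ad (linvE Lp Lq pq qp) (linvE Lq Lp qp pq).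
Qed.

(** * Gauge transformation by the product of a power series and a constant *)

Section Gauge.
Context {V : pzRingType}.
Variables (p q : int -> V) (g h : V).
Hypotheses (p0 : val_ge 0 p) (q0 : val_ge 0 q).
Hypotheses (pq : lmul p q = lconst 1) (qp : lmul q p = lconst 1).
Hypotheses (gh : g * h = 1) (hg : h * g = 1).

Let Lp := val_ge_laurent p0.
Let Lq := val_ge_laurent q0.
Let Lg := is_laurent_lconst g.
Let Lh := is_laurent_lconst h.

Let L := lmul p (lconst g).
Let M := lmul (lconst h) q.

Let LL : is_laurent L. Proof. exact: is_laurent_lmul. Qed.
Let LM : is_laurent M. Proof. exact: is_laurent_lmul. Qed.

Let LME : lmul L M = lconst 1.
Proof.
by rewrite /L /M -lmulA// [lmul (lconst g) _]lmulA// lmul_lconst gh lmul1l.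
Qed.

Let MLE : lmul M L = lconst 1.
Proof.
by rewrite /L /M -lmulA// [lmul q _]lmulA// qp lmul1l lmul_lconst hg.
Qed.

Lemma linv_gauge : linv L = M.
Proof. exact: linvE LL LM LME MLE. Qed.

Lemma linv_linv_gauge : linv (linv L) = L.
Proof. by rewrite linv_gauge; exact: linvE LM LL MLE LME. Qed.

Lemma Ad_linv_gauge F : is_laurent F ->
  Ad (linv L) F = fun k => h * lmul (lmul q F) p k * g.
Proof.
move=> LF; rewrite /Ad linv_linv_gauge linv_gauge /L /M.
have LqF : is_laurent (lmul q F) by exact: is_laurent_lmul.
have LqFp : is_laurent (lmul (lmul q F) p) by exact: is_laurent_lmul.
rewrite -(lmulA Lh Lq LF) -(lmulA Lh LqF)// (lmulA LqF Lp Lg).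
by rewrite (lmulA Lh LqFp Lg) lmul_lconstr lmul_lconstl.
Qed.

(** Multiplication on the right by p removes the inverse of p, whose coefficients are unknown; the
    constant g has no derivative and only conjugates W. *)
Lemma gauge_equation W T : is_laurent W ->
    Ad L W - lmul (lderiv L) (linv L) = T ->
  lmul p (fun k => g * W k * h) - lderiv p = lmul T p.
Proof.
move=> LW; set B := fun k => _; rewrite /Ad linv_gauge => E.
have LB : is_laurent B.
  by case: LW => b W0; exists b => k kb; rewrite /B W0 ?mulr0 ?mul0r.
have Ld : is_laurent (lderiv p).
  by exists (-1) => k k1; rewrite /lderiv p0 ?mul0rz//; lia.
have LpB : is_laurent (lmul p B) by exact: is_laurent_lmul.
have BE : B = lmul (lmul (lconst g) W) (lconst h) by rewrite lmul_lconstr lmul_lconstl.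
have LgW : is_laurent (lmul (lconst g) W) by exact: is_laurent_lmul.
have E1 : lmul (lmul L W) M = lmul (lmul p B) q.
  rewrite /L /M (lmulA _ Lh Lq); last exact: is_laurent_lmul.
  by rewrite BE (lmulA Lp LgW Lh) (lmulA Lp Lg LW).
have E2 : lmul (lderiv L) M = lmul (lderiv p) q.
  rewrite /L /M lderiv_lmulr -(lmulA Ld Lg LM) (lmulA Lg Lh Lq) lmul_lconst gh.
  by rewrite lmul1l.
have Lpq B' : is_laurent B' -> is_laurent (lmul B' q) by move=> ?; exact: is_laurent_lmul.
rewrite -E E1 E2 (lmulBl (Lpq _ LpB) (Lpq _ Ld) Lp).
by rewrite -(lmulA LpB Lq Lp) -(lmulA Ld Lq Lp) qp !lmul1r.
Qed.

End Gauge.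

Section LocalAnalysis.
Context {R : realType} {n : nat}.
Local Notation C := (Cplx R).
Implicit Types (g u D X : 'M[C]_n) (a da : C) (p q W L : int -> 'M[C]_n).
Local Notation N' := (@matN R n)^T.
Local Notation E' := (@matE R n)^T.

Lemma lmulmx_val2 L W (b c : int) : val_ge b L -> val_ge c W ->
  lmul L W (b + c) = L b *m W c.
Proof. exact: lmul_val2. Qed.

Lemma lmulmx_val2S L W (b c : int) : val_ge b L -> val_ge c W ->
  lmul L W (b + c + 1) = L b *m W (c + 1) + L (b + 1) *m W c.
Proof. exact: lmul_val2S. Qed.

Lemma lmulmx_val2SS L W (b c : int) : val_ge b L -> val_ge c W ->
  lmul L W (b + c + 2) =
  L b *m W (c + 2) + L (b + 1) *m W (c + 1) + L (b + 2) *m W c.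
Proof. exact: lmul_val2SS. Qed.

Lemma Ad_lconst g L : g \in unitmx -> Ad (lconst g) L = fun k => Adm g (L k).
Proof.
move=> gU; rewrite /Ad (@linv_lconst _ g (invmx g)); [|exact: mulmxV|exact: mulVmx].
by rewrite lmul_lconstl lmul_lconstr.
Qed.

Lemma P1_inverse p : P1 p -> exists q, [/\ val_ge 0 p, val_ge 0 q,
  lmul p q = lconst 1, lmul q p = lconst 1 & exists2 u, lie_u u & p 0 = 1%:M + u].
Proof.
move=> [pO pu].
have p0 : val_ge 0 p.
  by move=> k k0; have := pO k k0; rewrite lfunD lfunN /lconst lt_eqF// subr0.
have pE : p 0 = 1%:M + (p 0 - 1%:M) by rewrite addrC subrK.
have {}pu : lie_u (p 0 - 1%:M) by [].
have pU : p 0 \in unitmx by rewrite pE unip_unitmx.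
have [q [q0 pq qp]] := laurent_inverse p0 (mulmxV pU) (mulVmx pU).
by exists q; split=> //; exists (p 0 - 1%:M).
Qed.

(** Ad(g_i) of the residue of alpha dz at the pole. *)
Definition leading_residue a D X : 'M[C]_n :=
  matHT - n%:R^-1 *: (a *: N' + D + X).

Lemma leading_coefs a g D X W : g \in unitmx ->
    gl_o (Ad (lconst g) W
          - zshift (-1) (lscale (- (a / n%:R)) (linv varpi)
                         - lscale n%:R^-1 (lconst (D + X)) + lconst matHT)) ->
  [/\ val_ge (-2) W, W (-2) = - (a / n%:R) *: Adm (invmx g) E'
    & Adm g (W (-1)) = leading_residue a D X].
Proof.
move=> gU; rewrite Ad_lconst// linv_varpi => lead.
(* The argument a = 0 leaves out the N' term, which is already supplied by [varpi_inv] in degree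
   0. *)
have E k : k < 0 -> Adm g (W k) =
    - (a / n%:R) *: varpi_inv (k + 1) + (if k == -1 then leading_residue 0 D X else 0).
  move=> /lead; rewrite lfunD lfunN => /eqP; rewrite subr_eq0 => /eqP ->.
  rewrite /zshift opprK !lfunD lfunN /lscale /lconst addr_eq0 -addrA; congr (_ + _).
  case: eqP => _; last by rewrite scaler0 oppr0 addr0.
  by rewrite /leading_residue scale0r add0r addrC.
have W0 M k : Adm g (W k) = M -> W k = Adm (invmx g) M.
  by move=> <-; rewrite AdmK.
split.
- move=> k k2; rewrite (W0 0 k) ?E; last by lia.
    by rewrite /Adm mulmx0 mul0mx.
  rewrite varpi_invE !ifF ?addr0 ?scaler0//; lia.
- rewrite -AdmZ; apply: W0; rewrite E// varpi_invE !addr_eq0 /=.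
  by rewrite add0r addr0.
rewrite E// varpi_invE addr_eq0 eqxx /= addr0 /leading_residue scale0r add0r.
exact: leading_residueE.
Qed.

Lemma val_ge_scaled_varpi_inv da : val_ge (-1) (lscale da (@varpi_inv R n)).
Proof. by move=> k k1; rewrite /lscale val_ge_varpi_inv// scaler0. Qed.

(* Conjugating by p, the z^-1 coefficient of the normalized formal type determines
   the commutator term E' p_1 - p_1 E' that enters the constant term of Ad(p^-1). *)
Lemma conj_varpi_inv a da g D X W p q : (0 < n)%N -> a != 0 -> g \in unitmx ->
    val_ge 0 p -> val_ge 0 q -> lmul p q = lconst 1 -> lmul q p = lconst 1 ->
    (exists2 u, lie_u u & p 0 = 1%:M + u) -> lie_u X ->
    val_ge (-2) W -> W (-2) = - (a / n%:R) *: Adm (invmx g) E' ->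
    Adm g (W (-1)) = leading_residue a D X ->
    Ad (lmul p (lconst g)) W
      - lmul (lderiv (lmul p (lconst g))) (linv (lmul p (lconst g)))
    = zshift (-1) (lscale (- (a / n%:R)) (linv varpi) + lconst matHT) ->
  let G := lmul (lmul q (lscale da varpi_inv)) p in
  [/\ val_ge (-1) G, G (-1) = da *: E'
    & lie_u (G 0 - da *: (N' + a^-1 *: D))].
Proof.
move=> n0 a0 gU p0 q0 pq qp [u uu pu] uX W2 Wm2 Wm1 formal G.
have F1 := val_ge_scaled_varpi_inv da.
have G1 : val_ge (-1) G.
  by have := val_ge_lmul (val_ge_lmul q0 F1) p0; rewrite add0r addr0.
have [Lp Lq] := (val_ge_laurent p0, val_ge_laurent q0).
have [LF LW] := (val_ge_laurent F1, val_ge_laurent W2).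
have pG : lmul p G = lmul (lscale da varpi_inv) p.
  rewrite /G lmulA//; last exact: is_laurent_lmul.
  by rewrite lmulA// pq lmul1l.
have pE : p 0 *m E' = E'.
  by rewrite pu mulmxDl mul1mx lie_u_mulr_matE// addr0.
have Ep : E' *m p 0 = E'.
  by rewrite pu mulmxDr mulmx1 lie_u_mull_matE// addr0.
have pU : p 0 \in unitmx by rewrite pu unip_unitmx.
have v0 : varpi_inv 0 = N' by rewrite varpi_invE /= addr0.
have v1 : varpi_inv (-1) = E' by rewrite varpi_invE /= add0r.
have Gm1 : G (-1) = da *: E'.
  have := congr1 (fun L => L (-1)) pG.
  have := lmulmx_val2 p0 G1; rewrite add0r => ->.
  have := lmulmx_val2 F1 p0; rewrite addr0 => ->.
  rewrite /lscale v1 -scalemxAl Ep => H.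
  by rewrite -[LHS](mulKmx pU) H -scalemxAr -[in LHS]pE mulKmx.
have G0 : p 0 *m G 0 = da *: (N' *m p 0 + E' *m p 1 - p 1 *m E').
  have := congr1 (fun L => L 0) pG.
  have := lmulmx_val2S p0 G1; rewrite add0r addNr add0r => ->.
  have := lmulmx_val2S F1 p0; rewrite addr0 addNr add0r => ->.
  by rewrite /lscale v1 v0 Gm1; exact: commutator_scaled.
(* In degree -1 the equation p B - p' = T p sees only [p 0] and [p 1], and the derivative of p drops
   out. *)
have key : p 0 *m leading_residue a D X - (a / n%:R) *: (p 1 *m E') =
    - (a / n%:R) *: (E' *m p 1) + (matHT - (a / n%:R) *: N') *m p 0.
  pose B k := Adm g (W k).
  have B2 : val_ge (-2) B by move=> k k2; rewrite /B W2// /Adm mulmx0 mul0mx.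
  pose T := zshift (-1) (lscale (- (a / n%:R)) varpi_inv + lconst (@matHT R n)).
  have TE k : T k = - (a / n%:R) *: varpi_inv (k + 1) + (if k == -1 then matHT else 0).
    by rewrite /T /zshift opprK lfunD /lscale /lconst addr_eq0.
  have T2 : val_ge (-2) T.
    by move=> k k2; rewrite TE val_ge_varpi_inv ?scaler0 ?add0r ?ifF//; lia.
  have H : lmul p B - lderiv p = lmul T p.
    apply: (gauge_equation p0 q0 pq qp (mulmxV gU) (mulVmx gU) LW).
    by rewrite formal linv_varpi.
  have pBm1 : lmul p B (-1) = p 0 *m B (-1) + p 1 *m B (-2).
    by have := lmulmx_val2S p0 B2; rewrite !add0r.
  have Tpm1 : lmul T p (-1) = T (-2) *m p 1 + T (-1) *m p 0.
    by have := lmulmx_val2S T2 p0; rewrite addr0 add0r.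
  have dpm1 : lderiv p (-1) = 0 by rewrite /lderiv addNr mulr0z.
  have Tm2 : T (-2) = - (a / n%:R) *: E' by rewrite TE /= v1 addr0.
  have Tm1 : T (-1) = - (a / n%:R) *: N' + matHT by rewrite TE addNr v0.
  have Bm2 : B (-2) = - (a / n%:R) *: E' by rewrite /B Wm2 AdmZ AdmVK.
  have := congr1 (fun L => L (-1)) H.
  rewrite lfunD lfunN dpm1 subr0 pBm1 Tpm1 Tm2 Tm1 Bm2 /B Wm1.
  exact: commutator_equation.
(* Membership in u may be tested after multiplication by the unipotent matrix [p 0], for which [G0]
   gives a closed formula. *)
split=> //; apply: (@lie_u_unip_mul _ _ u) => //; rewrite -pu mulmxBr G0.
have nn : n%:R != 0 :> C by rewrite pnatr_eq0 -lt0n.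
have {}key : (a / n%:R) *: (N' *m p 0 + E' *m p 1 - p 1 *m E') =
    matHT *m p 0 - p 0 *m leading_residue a D X.
  by apply: commutator_solve; rewrite key mulmxBl -scalemxAl.
(* Besides p_0 (N' + D / a), only the commutator of H_T with p_0 and the product p_0 X remain; both
   are strictly upper triangular. *)
have {}key : N' *m p 0 + E' *m p 1 - p 1 *m E' =
    (n%:R / a) *: (matHT *m p 0 - p 0 *m matHT)
    + p 0 *m (N' + a^-1 *: D) + a^-1 *: (p 0 *m X).
  rewrite mulmxDr -scalemxAr; apply: commutator_divide => //.
  by rewrite key /leading_residue mulmxBr -scalemxAr !mulmxDr -scalemxAr.
rewrite key -scalemxAr -scalerBr; apply: lie_uZ; rewrite addrAC addrK.
apply: lie_uD; apply: lie_uZ.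
  rewrite pu mulmxDr mulmxDl mulmx1 mul1mx opprD addrACA subrr add0r.
  exact: matHT_comm_u.
by rewrite pu mulmxDl mul1mx; apply: lie_uD => //; exact: lie_uM.
Qed.

End LocalAnalysis.

(** * The isomonodromy equations *)

Section BracketIdentities.
Context {F : fieldType} {n : nat}.
Implicit Types (M P Q T : 'M[F]_n) (a b t d : F).

(** Used with t = n, M = E' and T, P, Q the brackets of E' with Ad(g_i) Y_0, N' and D_i. The E'
    terms balance because 1 - (n - 1) / n = 1 / n. *)
Lemma second_order_identity a b t M T P Q : a != 0 -> t != 0 ->
  - (t^-1 * b) *: M - (a / t) *: (T - b *: (P + a^-1 *: Q))
  = - (b *: M) - (a / t) *: T
    + b *: (((t - 1) / t) *: M - t^-1 *: (- (a *: P) - Q)).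
Proof.
by move=> a0 t0; apply/matrixP => i j; rewrite !mxE; field; rewrite ?a0 ?t0.
Qed.

Lemma first_order_identity a b (da db : F) t d M P Q :
  d != 0 ->
  - (a * t) *: (- d ^- 2 *: (db *: M)) + d^-1 *: (db *: (- P))
    + da *: (d ^- 2 *: (- (b * t) *: (- M)) + d^-1 *: (- Q))
  = (- d)^-1 *: (db *: P + da *: Q) + (t * (- d) ^- 2 * (da * b + a * db)) *: M.
Proof.
by move=> d0; apply/matrixP => i j; rewrite !mxE; field; rewrite ?oppr_eq0 ?d0.
Qed.

Lemma sum2_sub (A1 A2 B1 B2 : 'M[F]_n) : A1 + A2 - (B2 + B1) = A1 - B1 + (A2 - B2).
Proof. by apply/matrixP => i j; rewrite !mxE; ring. Qed.

Lemma sum3_sub (A1 A2 A3 B1 B2 B3 : 'M[F]_n) :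
  A1 + A2 + A3 - (B3 + B2 + B1) = A1 - B1 + (A2 - B2) + (A3 - B3).
Proof. by apply/matrixP => i j; rewrite !mxE; ring. Qed.

End BracketIdentities.

Section Family.
Context {R : realType} {I : finType} {n m : nat}.
Local Notation C := (Cplx R).
Local Notation ratfun := {fraction {poly C}}.
Local Notation N' := (@matN R n)^T.
Local Notation E' := (@matE R n)^T.

Lemma phiE (L : int -> 'M[C]_n) : phi L = L 0.
Proof. by rewrite /phi /residue /zshift subrr. Qed.

(** U acts freely on GL_n: equal second components force u = 1. *)
Lemma eq_fibre_unit (A B g : 'M[C]_n) : g \in unitmx ->
  eq_fibre A B g g <-> lie_u (B - A).
Proof.
move=> gU; have Adm1 : Adm 1%:M A = A by rewrite /Adm invmx1 mulmx1 mul1mx.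
split=> [[u [_ gE uBA]]|uBA].
  have u1 : u = 1%:M by rewrite -[u](mulmxK gU) -gE mulmxV.
  by move: uBA; rewrite u1 Adm1.
exists 1%:M; split; rewrite ?mul1mx ?Adm1//.
by split=> [k _|]; rewrite subrr//; exact: lie_u0.
Qed.

(** The factor 1/z cancels the z in g^1 = z g, so condition (II) constrains only the polar
    coefficients. *)
Lemma zshift_gl_o1 (L : int -> 'M[C]_n) :
  (zshift (-1) @` gl_o1) L <-> val_ge 0 L.
Proof.
split=> [[_ [M M0 <-] <-] k k0|L0].
  by rewrite /zshift opprK addrK M0.
exists (zshift 1 L); last by apply/funext => k; rewrite /zshift opprK addrK.
by exists L.
Qed.

Lemma lbracketE (L M : int -> 'M[C]_n) : val_ge (-2) L -> val_ge (-1) M ->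
  [/\ val_ge (-3) (lbracket L M),
      lbracket L M (-3) = bracket (L (-2)) (M (-1)),
      lbracket L M (-2) = bracket (L (-2)) (M 0) + bracket (L (-1)) (M (-1))
    & lbracket L M (-1) = bracket (L (-2)) (M 1) + bracket (L (-1)) (M 0)
                          + bracket (L 0) (M (-1))].
Proof.
move=> L2 M1; split; rewrite /lbracket.
- by move=> k k3; rewrite lfunD lfunN (val_ge_lmul L2 M1)// (val_ge_lmul M1 L2)// subrr.
- rewrite lfunD lfunN; have := lmulmx_val2 L2 M1; rewrite [-2 + -1](_ : _ = -3)// => ->.
  by have := lmulmx_val2 M1 L2; rewrite [-1 + -2](_ : _ = -3)// => ->.
- rewrite lfunD lfunN; have := lmulmx_val2S L2 M1.
  rewrite [-2 + -1 + 1](_ : _ = -2)// => ->; have := lmulmx_val2S M1 L2.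
  rewrite [-1 + -2 + 1](_ : _ = -2)// => ->.
  rewrite [-1 + 1](_ : _ = 0)// [-2 + 1](_ : _ = -1)// /bracket.
  exact: sum2_sub.
rewrite lfunD lfunN; have := lmulmx_val2SS L2 M1.
rewrite [-2 + -1 + 2](_ : _ = -1)// => ->; have := lmulmx_val2SS M1 L2.
rewrite [-1 + -2 + 2](_ : _ = -1)// => ->.
rewrite [-1 + 1](_ : _ = 0)// [-1 + 2](_ : _ = 1)// [-2 + 1](_ : _ = -1)//.
rewrite [-2 + 2](_ : _ = 0)// /bracket.
exact: sum3_sub.
Qed.

Lemma bracket_frame_velocity (A T P Q u : 'M[C]_n) (b t : C) : bracket A u = 0 ->
  bracket A (T - b *: (P + t *: Q) - u) =
  bracket A T - b *: (bracket A P + t *: bracket A Q).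
Proof.
move=> uA; rewrite bracketDr bracketNr uA oppr0 addr0 bracketDr bracketNr.
by rewrite bracketZr bracketDr bracketZr.
Qed.

Lemma bracket_residue (H A P Q u : 'M[C]_n) (b c t : C) : bracket A u = 0 ->
    bracket H A = c *: A ->
  bracket (H - t *: (b *: P + Q + u)) A =
  c *: A - t *: (- (b *: bracket A P) - bracket A Q).
Proof.
move=> uA HA; rewrite bracketDl HA bracketNl bracketZl 2!bracketDl bracketZl.
rewrite [bracket u A]bracketC uA oppr0 addr0.
by rewrite [bracket P A]bracketC [bracket Q A]bracketC scalerN.
Qed.

(** The share of the pole j in the residue at the pole i, with d = xi_i - xi_j and t = 1 / n. The
    two double poles contribute a_i da_j and a_j da_i with the same sign, which is why d(a_i a_j)
    appears. *)
Lemma bracket_two_poles (Fi Fj ri rj : 'M[C]_n) (ai aj bi bj t d : C) : d != 0 ->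
  bracket (- (ai * t) *: Fi) (- d ^- 2 *: (bj *: Fj)) + bracket ri (d^-1 *: (bj *: Fj))
  + bracket (d ^- 2 *: (- (aj * t) *: Fj) + d^-1 *: rj) (bi *: Fi) =
  (- d)^-1 *: (bj *: bracket Fj ri + bi *: bracket Fi rj)
  + (t * (- d) ^- 2 * (bi * aj + ai * bj)) *: bracket Fi Fj.
Proof.
move=> d0; rewrite -first_order_identity//.
rewrite bracketZl !bracketZr bracketDl !bracketZl [bracket Fj Fi]bracketC.
by rewrite [bracket Fj ri]bracketC [bracket Fi rj]bracketC !opprK.
Qed.

(** * Conditions (I) and (II) at a fixed point and tangent vector, coefficient by coefficient *)

Section Pole.
Context (Delta : set 'rV[C]_m) (xi : I -> C).
Context (alpha : 'rV[C]_m -> 'M[ratfun]_n) (g : I -> 'rV[C]_m -> 'M[C]_n).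
Context (a : I -> 'rV[C]_m -> C) (D X : I -> 'rV[C]_m -> 'M[C]_n).
Context (p : I -> 'rV[C]_m -> int -> 'M[C]_n).
Hypothesis n0 : (0 < n)%N.
Hypothesis xi_inj : injective xi.
Hypothesis ff : framed_family Delta xi alpha g a D X p.
Variable y : 'rV[C]_m.
Hypothesis Dy : Delta y.

Let W i := expand_mx (xi i) (alpha y).
Let F i := Adm (invmx (g i y)) E'.
Let rh i := rho xi alpha i y.
Let gU i : g i y \in unitmx := ff_g_unit ff i Dy.

Let W_coefs i : [/\ val_ge (-2) (W i), W i (-2) = - (a i y / n%:R) *: F i
    & Adm (g i y) (W i (-1)) = leading_residue (a i y) (D i y) (X i y)].
Proof. exact: leading_coefs (gU i) (ff_leading ff i Dy). Qed.

Lemma expand_alpha i k : W i k =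
  \sum_j (geo2 (xi i) (xi j) k *: (- (a j y / n%:R) *: F j) + geo (xi i) (xi j) k *: rh j).
Proof.
have [K [P [aE _]]] := ff_alpha ff.
rewrite {1}/W (expand_mx_proper xi_inj); first last.
- by move=> j; have [] := W_coefs j.
- move=> b c; apply: (@proper_regular _ _ xi _ K (P y b c)).
    by rewrite (aE y Dy) !mxE.
  exact: (ff_infty ff Dy).
by apply: eq_bigr => j _; have [_ <- _] := W_coefs j.
Qed.

Variable v : 'rV[C]_m.
Let da i : C := 'd (a i) y v.
Let om i := 'd (g i) y v *m invmx (g i y).

(** One computation serves twice: the coefficient of degree -1 gives Upsilon, the one of degree 0
    gives condition (I). *)
Lemma conj_formA i (G : int -> 'M[C]_n) :
    Ad (linv (p i y)) (@formA R I n m a i y v) = G ->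
  [/\ val_ge (-1) G, G (-1) = da i *: E',
    lie_u (G 0 - da i *: (N' + (a i y)^-1 *: D i y))
  & Ad (linv (ghat g p i y)) (@formA R I n m a i y v) = fun k => Adm (invmx (g i y)) (G k)].
Proof.
have [q [p0 q0 pq qp pu]] := P1_inverse (ff_p_P1 ff i Dy).
have LF : is_laurent (@formA R I n m a i y v).
  by rewrite /formA linv_varpi; exact: val_ge_laurent (@val_ge_scaled_varpi_inv _ _ _).
have [Lp Lq] := (val_ge_laurent p0, val_ge_laurent q0).
move=> GE; rewrite (Ad_linv _ Lp Lq pq qp) in GE.
rewrite -{}GE; have [W2 Wm2 Wm1] := W_coefs i.
have formal := ff_formal_type ff i Dy.
have uX := ff_X_u ff i Dy.
have [G1 Gm1 G0] := conj_varpi_inv (da i) n0 (ff_a_neq0 ff i Dy) (gU i)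
  p0 q0 pq qp pu uX W2 Wm2 Wm1 formal.
rewrite {1 2 3}/formA linv_varpi; split=> //.
rewrite (Ad_linv_gauge p0 q0 pq qp (mulmxV (gU i)) (mulVmx (gU i)) LF).
by apply/funext => k; rewrite /Adm invmxK.
Qed.

Let Y i := expand_mx (xi i) (Upsilon0 xi g a p y v).

Lemma expand_Upsilon0 i k : Y i k = \sum_j geo (xi i) (xi j) k *: (da j *: F j).
Proof.
rewrite /Y /Upsilon0 -expand_mx_simple_poles; congr (expand_mx _ _ k).
apply: eq_bigr => j _; rewrite /Upsilon.
have [G1 Gm1 _ ->] := conj_formA (erefl (Ad (linv (p j y)) (@formA R I n m a j y v))).
rewrite principal_part_simple => [|l l1]; first by rewrite Gm1 AdmZ.
by rewrite G1// /Adm mulmx0 mul0mx.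
Qed.

Lemma sum_geo_neg i k (B : I -> 'M[C]_n) : k < 0 ->
  \sum_j geo (xi i) (xi j) k *: B j = (k == -1)%:R *: B i.
Proof.
move=> k0; rewrite (bigD1 i)//= geoxx big1 ?addr0// => j ji.
by rewrite geo_neg ?scale0r// inj_eq// eq_sym.
Qed.

Lemma val_ge_Y i : val_ge (-1) (Y i).
Proof.
move=> k k1; rewrite expand_Upsilon0 sum_geo_neg; last by lia.
by rewrite lt_eqF// scale0r.
Qed.

Lemma Y_m1 i : Y i (-1) = da i *: F i.
Proof. by rewrite expand_Upsilon0 sum_geo_neg// eqxx scale1r. Qed.

Lemma Y_0 i : Y i 0 = \sum_(j | j != i) (xi i - xi j)^-1 *: (da j *: F j).
Proof.
rewrite expand_Upsilon0 (bigD1 i)//= geoxx scale0r add0r.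
by apply: eq_bigr => j ji; rewrite geo_0// inj_eq// eq_sym.
Qed.

Lemma Y_1 i : Y i 1 = \sum_(j | j != i) - (xi i - xi j) ^- 2 *: (da j *: F j).
Proof.
rewrite expand_Upsilon0 (bigD1 i)//= geoxx scale0r add0r.
by apply: eq_bigr => j ji; rewrite geo_1// inj_eq// eq_sym.
Qed.

Lemma W_0 i : W i 0 = \sum_(j | j != i)
  ((xi i - xi j) ^- 2 *: (- (a j y / n%:R) *: F j) + (xi i - xi j)^-1 *: rh j).
Proof.
rewrite expand_alpha (bigD1 i)//= geoxx geo2xx !scale0r !add0r.
by apply: eq_bigr => j ji; rewrite geo_0 ?geo2_0// inj_eq// eq_sym.
Qed.

Let frame_rhs i := \sum_(j | j != i) (xi i - xi j)^-1 *:
     Adm (g i y *m invmx (g j y)) (da j *: E')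
   - (da i *: N' + (da i / a i y) *: D i y).

Lemma frame_rhsE i : frame_rhs i = Adm (g i y) (Y i 0) - da i *: (N' + (a i y)^-1 *: D i y).
Proof.
have -> : Adm (g i y) (Y i 0) = \sum_(j | j != i) (xi i - xi j)^-1 *:
     Adm (g i y *m invmx (g j y)) (da j *: E').
  rewrite Y_0 Adm_sum; apply: eq_bigr => j _.
  by rewrite Adm_mulmx ?unitmx_inv// /F !AdmZ.
set Z := (X in _ = _ - X).
have -> : Z = da i *: N' + (da i / a i y) *: D i y by rewrite /Z scalerDr scalerA.
by [].
Qed.

Lemma isomonodromy1_at i :
  lie_u (phi (Ad (linv (p i y)) (@formA R I n m a i y v) + lconst (om i))
         - phi (Ad (lconst (g i y)) (Y i)))
  <-> lie_u (frame_rhs i - om i).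
Proof.
have [_ _ uG _] := conj_formA (erefl (Ad (linv (p i y)) (@formA R I n m a i y v))).
rewrite !phiE Ad_lconst// lfunD {1}/lconst eqxx frame_rhsE.
set G := Ad _ _ in uG *; set T := Adm _ _; set Z := da i *: _ in uG *.
(* The two matrices to be tested add up to G_0 - Z, which lies in u. *)
split=> [h|h].
  rewrite (_ : T - Z - om i = (G 0 - Z) - (G 0 + om i - T)).
    exact: lie_uB.
  by rewrite !opprD opprK; apply/matrixP => b c; rewrite !mxE; ring.
rewrite (_ : G 0 + om i - T = (G 0 - Z) - (T - Z - om i)).
  exact: lie_uB.
by apply/matrixP => b c; rewrite !mxE; ring.
Qed.

Let lax_rhs i := lderiv (Y i) + lbracket (W i) (Y i).

Lemma lax_rhs_low i k : k < -2 -> lax_rhs i k = 0.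
Proof.
move=> k2; have [W2 Wm2 _] := W_coefs i; have Y1 := @val_ge_Y i.
have [L3 Lm3 _ _] := lbracketE W2 Y1.
rewrite /lax_rhs lfunD /lderiv Y1 ?mul0rz ?add0r; last by lia.
have [k3|k3] := ltP k (-3); first exact: L3.
have -> : k = -3 by lia.
by rewrite Lm3 Wm2 Y_m1 bracketZl bracketZr bracketAA !scaler0.
Qed.

Lemma lax_rhs_m2E i : lax_rhs i (-2) = - (da i *: F i)
  + (- (a i y / n%:R) *: bracket (F i) (Y i 0) + da i *: bracket (rh i) (F i)).
Proof.
have [W2 Wm2 _] := W_coefs i; have [_ _ Lm2 _] := lbracketE W2 (@val_ge_Y i).
rewrite /lax_rhs lfunD Lm2 Wm2 Y_m1 bracketZl bracketZr; congr (_ + _).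
by rewrite /lderiv (_ : -2 + 1 = -1 :> int)// Y_m1 mulrN1z.
Qed.

Hypothesis Dy_near : \forall y' \near y, Delta y'.

Lemma differentiable_a i : differentiable (a i) y.
Proof. by apply: analytic_at_differentiable; exact: (ff_a ff i). Qed.

Lemma differentiable_g i : differentiable (g i) y.
Proof.
apply: differentiable_mx => j k.
by apply: analytic_at_differentiable; exact: (ff_g ff i j k).
Qed.

Lemma diff_alpha_low i k : k < -2 ->
  'd (fun y' => expand_mx (xi i) (alpha y') k) y v = 0.
Proof.
move=> k2; pose z : 'rV[C]_m -> 'M[C]_n := cst 0.
have zE : \forall y' \near y, z y' = expand_mx (xi i) (alpha y') k.
  apply: filterS Dy_near => y' Dy'.
  have [W2 _ _] := leading_coefs (ff_g_unit ff i Dy') (ff_leading ff i Dy').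
  by rewrite W2.
have dz : differentiable z y by exact: differentiable_cst.
by rewrite (near_eq_diff zE dz) diff_cst.
Qed.

Lemma diff_alpha_m2 i :
  'd (fun y' => expand_mx (xi i) (alpha y') (-2)) y v =
  Adm (invmx (g i y))
    (- (n%:R^-1 * da i) *: E' - (a i y / n%:R) *: bracket E' (om i)).
Proof.
pose s := a i * cst (- n%:R^-1).
have dcst : differentiable (cst (- n%:R^-1) : 'rV[C]_m -> C) y by exact: differentiable_cst.
have dai := differentiable_a i.
have ds : differentiable s y by exact: differentiableM.
have unit_near : \forall y' \near y, g i y' \in unitmx.
  by apply: filterS Dy_near => y' Dy'; exact: (ff_g_unit ff).
have lead_near : \forall y' \near y, expand_mx (xi i) (alpha y') (-2) =
    s y' *: (invmx (g i y') *m E' *m g i y').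
  apply: filterS Dy_near => y' Dy'.
  have [_ -> _] := leading_coefs (ff_g_unit ff i Dy') (ff_leading ff i Dy').
  by rewrite /Adm invmxK /s mulrN.
rewrite (diff_conj v (differentiable_g i) ds unit_near lead_near).
have -> : 'd s y v = - (n%:R^-1 * da i).
  have d0 : 'd (cst (- n%:R^-1) : 'rV[C]_m -> C) y v = 0 by rewrite diff_cst.
  apply: etrans (diffM_val v dai dcst) _.
  apply: etrans (congr1 (fun t => 'd (a i) y v * (- n%:R^-1) + a i y * t) d0) _.
  by rewrite mulr0 addr0 mulrN mulrC.
have -> : s y = - (a i y / n%:R) by rewrite /s mulrN.
by rewrite [RHS]AdmD AdmN !AdmZ /Adm invmxK [X in _ + X = _]scaleNr.
Qed.

Lemma lax_rhs_m2_eq_diff i : lie_u (frame_rhs i - om i) ->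
  lax_rhs i (-2) = 'd (fun y' => expand_mx (xi i) (alpha y') (-2)) y v.
Proof.
move=> uU; have [_ _ Wm1] := W_coefs i.
have nn : n%:R != 0 :> C by rewrite pnatr_eq0 -lt0n.
set T := Adm (g i y) (Y i 0).
have bU (u : 'M[C]_n) : lie_u u -> bracket E' u = 0.
  by move=> uu; rewrite /bracket lie_u_mulr_matE// lie_u_mull_matE// subrr.
(* The first system fixes the frame velocity only up to u, and the bracket with E' removes exactly
   this ambiguity. *)
have bom : bracket E' (om i) = bracket E' T
    - da i *: (bracket E' N' + (a i y)^-1 *: bracket E' (D i y)).
  have -> : om i = T - da i *: (N' + (a i y)^-1 *: D i y) - (frame_rhs i - om i).
    by rewrite -frame_rhsE opprB addrC subrK.
  exact: bracket_frame_velocity (bU _ uU).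
have bS : bracket (leading_residue (a i y) (D i y) (X i y)) E' =
    ((n%:R - 1) / n%:R) *: E'
    - n%:R^-1 *: (- (a i y *: bracket E' N') - bracket E' (D i y)).
  exact: bracket_residue (bU _ (ff_X_u ff i Dy)) (bracket_HT_matE n0).
(* Both sides are brought to the form Ad(g_i^-1) of a matrix in the frame, where E', N', D_i and H_T
   are explicit. *)
have -> : lax_rhs i (-2) = Adm (invmx (g i y)) (- (da i *: E') - (a i y / n%:R) *: bracket E' T
    + da i *: bracket (leading_residue (a i y) (D i y) (X i y)) E').
  rewrite lax_rhs_m2E -Wm1 AdmD AdmZ Adm_bracket ?unitmx_inv// AdmK//.
  rewrite AdmB AdmN !AdmZ Adm_bracket ?unitmx_inv// AdmK//.
  by rewrite scaleNr addrA.
rewrite diff_alpha_m2; congr Adm; rewrite bom bS.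
by rewrite second_order_identity// (ff_a_neq0 ff).
Qed.

(** The term j = i drops out: at its own pole a polar part has no coefficient in degree 0 or 1, and
    the derivative of Y has none in degree -1. *)
Lemma lax_rhs_m1 i : lax_rhs i (-1) =
  \sum_(j | j != i)
       ((xi j - xi i)^-1 *: (da j *: bracket (F j) (rh i) + da i *: bracket (F i) (rh j))
        + (n%:R^-1 * (xi j - xi i) ^- 2 * 'd (fun y' => a i y' * a j y') y v) *:
          bracket (F i) (F j)).
Proof.
have [W2 Wm2 _] := W_coefs i; have [_ _ _ Lm1] := lbracketE W2 (@val_ge_Y i).
rewrite /lax_rhs lfunD Lm1 /lderiv addNr mulr0z add0r Wm2 Y_m1 Y_1 Y_0 W_0.
rewrite !bracket_sumr bracket_suml -!big_split /=; apply: eq_bigr => j ji.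
have dij : xi i - xi j != 0 by rewrite subr_eq0 inj_eq// eq_sym.
have -> : 'd (fun y' => a i y' * a j y') y v = da i * a j y + a i y * da j.
  exact: diffM_val (differentiable_a i) (differentiable_a j).
have -> : xi j - xi i = - (xi i - xi j) by rewrite opprB.
exact: bracket_two_poles.
Qed.

End Pole.
End Family.

Theorem proposition7p1 (R : realType) (I : finType) (n m : nat)
  (c : 'rV[Cplx R]_m) (r : 'I_m -> Cplx R)
  (xi : I -> Cplx R)
  (alpha : 'rV[Cplx R]_m -> 'M[{fraction {poly (Cplx R)}}]_n)
  (g : I -> 'rV[Cplx R]_m -> 'M[Cplx R]_n)
  (a : I -> 'rV[Cplx R]_m -> Cplx R)
  (D X : I -> 'rV[Cplx R]_m -> 'M[Cplx R]_n)
  (p : I -> 'rV[Cplx R]_m -> int -> 'M[Cplx R]_n) :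
  (0 < n)%N ->
  (forall k, 0 < r k) ->
  injective xi ->
  framed_family (polydisk c r) xi alpha g a D X p ->
  (forall i, isomonodromy1 (polydisk c r) xi g a p i /\
             isomonodromy2 (polydisk c r) xi alpha g a p i)
  <->
  (forall i y v, polydisk c r y ->
     eq_fibre
       ('d (g i) y v *m invmx (g i y))
       (\sum_(j | j != i) (xi i - xi j)^-1 *:
           Adm (g i y *m invmx (g j y)) ('d (a j) y v *: matE^T)
        - ('d (a i) y v *: matN^T + ('d (a i) y v / a i y) *: D i y))
       (g i y) (g i y)) /\
  (forall i y v, polydisk c r y ->
     'd (rho xi alpha i) y v =
     \sum_(j | j != i)
       ((xi j - xi i)^-1 *:
          ('d (a j) y v *:
             bracket (Adm (invmx (g j y)) matE^T) (rho xi alpha i y)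
           + 'd (a i) y v *:
             bracket (Adm (invmx (g i y)) matE^T) (rho xi alpha j y))
        + (n%:R^-1 * (xi j - xi i) ^- 2
             * 'd (fun y' => a i y' * a j y') y v) *:
          bracket (Adm (invmx (g i y)) matE^T) (Adm (invmx (g j y)) matE^T))).
Proof.
move=> n0 _ xi_inj ff; set Delta := polydisk c r in ff *.
have gU i y : Delta y -> g i y \in unitmx by move=> Dy; exact: (ff_g_unit ff).
split=> [iso|[eq1 eq2] i].
  split=> i y v Dy.
    apply/(eq_fibre_unit _ _ (gU i y Dy))/(isomonodromy1_at n0 xi_inj ff Dy).
    exact: (iso i).1.
  (* [rho] is by definition the coefficient of degree -1 of the connection, so this is (II) in that
     degree. *)
  rewrite -(lax_rhs_m1 n0 xi_inj ff Dy).
  by have /zshift_gl_o1/(_ (-1) isT)/lfunB_eq0 := (iso i).2 y v Dy.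
(* Extracted beforehand because both (I) and the degree -2 part of (II) rest on it. *)
have lie1 y v : Delta y -> lie_u _ := fun Dy =>
  (eq_fibre_unit _ _ (gU i y Dy)).1 (eq1 i y v Dy).
split=> [y v Dy|y v Dy /=].
  by apply/(isomonodromy1_at n0 xi_inj ff Dy); exact: lie1.
apply/zshift_gl_o1 => k k0; apply/lfunB_eq0.
have [k2|k2] := ltP k (-2).
  by rewrite (lax_rhs_low n0 xi_inj ff Dy)// (diff_alpha_low ff v (polydisk_nbhs Dy)).
have [->|k1] := eqVneq k (-2).
  by rewrite (lax_rhs_m2_eq_diff n0 xi_inj ff Dy (polydisk_nbhs Dy))//; exact: lie1.
have -> : k = -1 by lia.
by rewrite (lax_rhs_m1 n0 xi_inj ff Dy); exact: eq2.
Qed.
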